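(* Let $\alpha\in(0,1)$, let $(a_0,b_0)$ be any pair of positive integers, and let $(\mathbb{Z}_{\alpha,n})_{n\ge0}$ be the $\alpha$-random walk starting at $(a_0,b_0)$. Then, almost surely, \[ \lim_{N\to\infty}\frac1N\sum_{n=1}^N I_k(\mathbb{Z}_{\alpha,n})=\frac{1}{k^2\zeta(2)}\quad\text{for all integers } k\ge1 . \]
   Context: $\mathbb{N}=\{1,2,3,\dots\}$ and $\zeta$ is the Riemann zeta function. For $\alpha\in(0,1)$, the $\alpha$-random walk $(\mathbb{Z}_{\alpha,n})_{n\ge0}$ starting at $(a_0,b_0)\in\mathbb{N}^2$ has $\mathbb{Z}_{\alpha,0}=(a_0,b_0)$ and independent identically distributed increments $\mathbb{Z}_{\alpha,n+1}-\mathbb{Z}_{\alpha,n}$, equal to $(1,0)$ with probability $\alpha$ and to $(0,1)$ with probability $1-\alpha$. For an integer $k\ge1$, $I_k(x,y)=1$ if $\gcd(x,y)=k$ and $I_k(x,y)=0$ otherwise. *)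

(* Defs.v *)
From HB Require Import structures.
From mathcomp Require Import all_boot all_order all_algebra.
From mathcomp Require Import finmap.
From mathcomp Require Import all_classical all_reals all_analysis.

Set Implicit Arguments.
Unset Strict Implicit.
Unset Printing Implicit Defensive.

Import Order.TTheory GRing.Theory Num.Theory.
Import numFieldNormedType.Exports.

Local Open Scope classical_set_scope.
Local Open Scope ring_scope.

(* The integers carry the discrete sigma-algebra, as [nat] does in the library;
   the product sigma-algebra on [int * int] is then discrete as well. *)
HB.instance Definition _ := isPointed.Build int 0.
HB.instance Definition _ := @isMeasurable.Build default_measure_display
  int discrete_measurable discrete_measurable0
  discrete_measurableC discrete_measurableU.

(* Mutual independence: the product rule on every finite subfamily. *)
Definition independent_family {R : realType} {d d' : measure_display}
    {T : measurableType d} {T' : measurableType d'} {I : choiceType}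
    (P : probability T R) (X : I -> T -> T') : Prop :=
  forall (J : {fset I}) (B : I -> set T'),
    (forall i, i \in J -> measurable (B i)) ->
    P (\bigcap_(i in [set` J]) (X i @^-1` B i)) =
      (\prod_(i <- J) P (X i @^-1` B i))%E.

(* Differences are taken in [int * int], since subtraction on [nat] truncates. *)
Definition increment {T : Type} (Z : nat -> T -> nat * nat) (n : nat) (w : T)
    : int * int :=
  ((Z n.+1 w).1%:Z - (Z n w).1%:Z, (Z n.+1 w).2%:Z - (Z n w).2%:Z).

Record random_walk {R : realType} {d : measure_display} {T : measurableType d}
    (P : probability T R) (alpha : R) (a0 b0 : nat)
    (Z : nat -> {RV P >-> (nat * nat)%type}) : Prop := RandomWalk {
  random_walk_start : forall w, Z 0%N w = (a0, b0);
  random_walk_indep : independent_family P (increment (fun n => Z n));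
  (* The two probabilities add up to 1, so this fixes the law of every
     increment, the same one for all [n]. *)
  random_walk_right : forall n,
    P (increment (fun m => Z m) n @^-1` [set (1, 0)]) = alpha%:E;
  random_walk_up : forall n,
    P (increment (fun m => Z m) n @^-1` [set (0, 1)]) = (1 - alpha)%:E
}.

Definition gcd_indicator (R : realType) (k : nat) (p : nat * nat) : R :=
  (gcdn p.1 p.2 == k)%:R.

(* The Dirichlet series of the Riemann zeta function, for real [s > 1]. *)
Definition zeta {R : realType} (s : R) : R :=
  limn (fun N : nat => \sum_(1 <= n < N.+1) n%:R `^ (- s)).

(* Main.v *)
Require Import Defs.
From mathcomp Require Import all_boot all_order all_algebra.
From mathcomp Require Import finmap.
From mathcomp Require Import all_classical all_reals all_analysis.
From mathcomp Require Import measurable_realfun.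
From mathcomp Require Import ring lra zify.

Set Implicit Arguments.
Unset Strict Implicit.
Unset Printing Implicit Defensive.

Import Order.TTheory GRing.Theory Num.Theory.
Import numFieldNormedType.Exports.
Local Open Scope classical_set_scope.
Local Open Scope ring_scope.

(** Let [X_n] be the number of right steps among the first [n], and put
    [t = a0 + b0]. The coordinates of [Z_n] add up to [t + n], so the gcd of
    [Z_n] is [g_n = gcd (a0 + X_n, t + n)]; hence [d] divides [g_n] iff [d]
    divides [t + n], a deterministic event of density [1/d], and [X_n] lies in
    one residue class modulo [d], which in the long run has probability [1/d].
    This suggests frequency [1/d^2] for the multiples of [d] among the [g_n].

    Two estimates on the walk modulo [d] make this precise. Both come from the
    identity [step_energy]: one step of the walk lowers the sum over a period
    of the squares of a [d]-periodic function by a constant times its Dirichlet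
    form. With the Poincare inequality on a cycle this gives exponential
    convergence to the uniform law at rate of order [1/d^2] ([mixing]), hence a
    variance of order [N * d^2] for the number of [n <= N] with [d] dividing
    [g_n] ([variance_le]). Applied to a point mass, it gives a bound on the
    probability of a residue class that decays with both [n] and [d]
    ([anticoncentration]), hence a first moment bound for the number of
    [n <= N] such that [g_n] is large ([mean_large_gcd]).

    The whole almost sure argument is carried by a single quantity,
    [sieve_error j]: along [N = j^12], it adds the errors of the frequencies of
    the multiples of [d] for all [d <= j^2] to the frequency of [g_n > j^2].
    Its mean is at most [C / j^2] ([mean_sieve_error]), which is summable in
    [j], so it tends to 0 almost surely.

    The rest is a statement on one sequence [g] of positive integers whose
    sieve error tends to 0 ([freq_eq_zeta]). Sieving by the primes up to [r]
    gives the frequency of [g_n = k] up to [1/r], so that this frequency tends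
    to [c / k^2] along [N = j^12] for a constant [c]. No mass escapes to large
    values of [g_n], hence [c] times the sum of all [1 / k^2] is 1, that is
    [c = 1 / zeta 2]. Counts are monotone in [N] and [(j+1)^12 / j^12] tends to
    1, which extends the limit to all [N]. *)

(** * Periodic functions and the walk on a cycle *)

Section Periodic.
Context {R : realType}.
Implicit Types (d k l n x y : nat) (f : nat -> R).

(** Functions on the cycle [Z/d] are encoded as [d]-periodic functions on
    [nat], and sums over the cycle as sums over the period [x < d]. This keeps
    one walk on [nat] for all [d]. *)
Definition periodic d f := forall x, f (x + d)%N = f x.

Definition dirichlet_form d f : R := \sum_(x < d) (f x.+1 - f x) ^+ 2.

Lemma sum_periodic_shift d f y : periodic d f ->
  \sum_(x < d) f (y + x)%N = \sum_(x < d) f x.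
Proof.
move=> fd; elim: y => [//|y <-].
apply: (addrI (f y)); rewrite -[in RHS](fd y) [RHS]addrC.
rewrite -(big_ord_recr d (fun i => f (y + i)%N)) big_ord_recl addn0.
by congr (_ + _); apply: eq_bigr => i _; rewrite addSnnS.
Qed.

Lemma sqr_sum_le k (a : nat -> R) :
  (\sum_(i < k) a i) ^+ 2 <= k%:R * \sum_(i < k) a i ^+ 2.
Proof.
elim: k => [|k IH]; first by rewrite !big_ord0 expr0n mulr0.
rewrite !big_ord_recr /=; set S := \sum_(i < k) a i in IH *.
set V := \sum_(i < k) a i ^+ 2 in IH *.
have cross : 2 * S * a k <= V + k%:R * a k ^+ 2.
  rewrite [2 * S * _](_ : _ = \sum_(i < k) 2 * a i * a k); last first.
    by rewrite -mulr_suml -mulr_sumr.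
  rewrite [leRHS](_ : _ = \sum_(i < k) (a i ^+ 2 + a k ^+ 2)); last first.
    by rewrite big_split /= sumr_const card_ord -[in RHS]mulr_natl.
  apply: ler_sum => i _; rewrite -subr_ge0.
  rewrite (_ : _ - _ = (a i - a k) ^+ 2); last by ring.
  exact: sqr_ge0.
rewrite -natr1; move: IH cross; set b := a k; set K := k%:R; lra.
Qed.

(** Cauchy-Schwarz along the [k] steps from [x] to [x + k]; those steps are
    distinct edges of the cycle because [k <= d]. *)
Lemma oscillation d f x k l : periodic d f -> (k <= l)%N -> (l <= d)%N ->
  (f x - f (x + k)%N) ^+ 2 <= l%:R * dirichlet_form d f.
Proof.
move=> fd kl ld; rewrite -sqrrN opprB.
have -> : f (x + k)%N - f x = \sum_(i < k) (f (x + i).+1 - f (x + i)%N).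
  rewrite -(big_mkord xpredT (fun i => f (x + i).+1 - f (x + i)%N)).
  under eq_bigr do rewrite -addnS.
  by rewrite (telescope_sumr (fun i => f (x + i)%N)) //= addn0.
apply: le_trans (sqr_sum_le k (fun i => f (x + i).+1 - f (x + i)%N)) _.
apply: ler_pM => //; first by apply: sumr_ge0 => i _; exact: sqr_ge0.
  by rewrite ler_nat.
rewrite /dirichlet_form.
have pD : periodic d (fun x => (f x.+1 - f x) ^+ 2).
  by move=> z; rewrite -addSn !fd.
rewrite -(sum_periodic_shift x pD) /=.
rewrite -(big_mkord xpredT (fun i => (f (x + i).+1 - f (x + i)%N) ^+ 2)).
rewrite -[leRHS](big_mkord xpredT (fun i => (f (x + i).+1 - f (x + i)%N) ^+ 2)).
rewrite [leRHS](big_cat_nat (leq0n k) (leq_trans kl ld)) /= lerDl.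
by apply: sumr_ge0 => i _; exact: sqr_ge0.
Qed.

(** A function of mean zero is at each point the average of its differences to
    the points of the cycle, and [oscillation] bounds each of those. *)
Lemma poincare d f : (0 < d)%N -> periodic d f -> \sum_(x < d) f x = 0 ->
  \sum_(x < d) f x ^+ 2 <= d%:R ^+ 2 * dirichlet_form d f.
Proof.
move=> d0 fd f0.
have dR : 0 < d%:R :> R by rewrite ltr0n.
have pt x : f x ^+ 2 <= d%:R * dirichlet_form d f.
  have e : d%:R * f x = \sum_(k < d) (f x - f (x + k)%N).
    by rewrite sumrB (sum_periodic_shift x fd) f0 subr0 sumr_const card_ord mulr_natl.
  have : (d%:R * f x) ^+ 2 <= d%:R * (d%:R * (d%:R * dirichlet_form d f)).
    rewrite e; apply: le_trans (sqr_sum_le d (fun k => f x - f (x + k)%N)) _.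
    rewrite ler_pM2l //.
    rewrite [leRHS](_ : _ = \sum_(k < d) (d%:R * dirichlet_form d f)); last first.
      by rewrite sumr_const card_ord mulr_natl.
    by apply: ler_sum => i _; apply: oscillation => //; exact: ltnW.
  rewrite exprMn [leRHS]mulrA -expr2 ler_pM2l //.
  exact: exprn_gt0.
apply: (@le_trans _ _ (\sum_(x < d) (d%:R * dirichlet_form d f))).
  by apply: ler_sum => x _; exact: pt.
by rewrite sumr_const card_ord -[leLHS]mulr_natl mulrA -expr2.
Qed.

End Periodic.

Section Step.
Context {R : realType} (alpha : R).
Hypothesis alpha01 : 0 < alpha < 1.
Implicit Types (d k l n x y : nat) (f : nat -> R).

(** The transition operator of the first coordinate: the mean of [f] after one
    more step of the walk from [x]. *)
Definition step f x : R := alpha * f x.+1 + (1 - alpha) * f x.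

Notation c := (alpha * (1 - alpha)).

Lemma spread_gt0 : 0 < c. Proof. by case/andP: alpha01 => a0 a1; rewrite mulr_gt0 ?subr_gt0. Qed.
Lemma spread_le1 : c <= 1.
Proof.
by case/andP: alpha01 => a0 a1; apply: mulr_ile1; lra.
Qed.

Lemma step_periodic d f : periodic d f -> periodic d (step f).
Proof. by move=> fd x; rewrite /step -addSn !fd. Qed.

Lemma iter_step_periodic d f n : periodic d f -> periodic d (iter n step f).
Proof. by move=> fd; elim: n => //= n IH; exact: step_periodic. Qed.

Lemma sum_step d f : periodic d f -> \sum_(x < d) step f x = \sum_(x < d) f x.
Proof.
move=> fd; rewrite /step big_split /= -!mulr_sumr.
by rewrite (sum_periodic_shift 1 fd) -mulrDl addrC subrK mul1r.
Qed.

Lemma sum_iter_step d f n : periodic d f ->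
  \sum_(x < d) iter n step f x = \sum_(x < d) f x.
Proof.
move=> fd; elim: n => //= n IH; rewrite -IH.
by rewrite (sum_step (iter_step_periodic n fd)).
Qed.

(** Per point this is the variance of a two-valued variable, [(p u + q v)^2 =
    p u^2 + q v^2 - p q (u - v)^2] for [p + q = 1]; the first two terms sum to
    the energy of [f] since shifts preserve sums over a period. *)
Lemma step_energy d f : periodic d f ->
  \sum_(x < d) step f x ^+ 2 = \sum_(x < d) f x ^+ 2 - c * dirichlet_form d f.
Proof.
move=> fd.
have f2d : periodic d (fun x => f x ^+ 2) by move=> x; rewrite fd.
rewrite /dirichlet_form mulr_sumr.
rewrite (eq_bigr (fun x : 'I_d => (alpha * f x.+1 ^+ 2 + (1 - alpha) * f x ^+ 2)
   - c * (f x.+1 - f x) ^+ 2)); last by move=> i _; rewrite /step; ring.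
rewrite sumrB; congr (_ - _); exact: sum_step f2d.
Qed.

Lemma step_le f b x : (forall y, f y <= b) -> step f x <= b.
Proof.
case/andP: alpha01 => a0 a1 fb; rewrite /step.
by move: (fb x.+1) (fb x); set u := f _; set v := f _; nra.
Qed.

Lemma step_ge0 f x : (forall y, 0 <= f y) -> 0 <= step f x.
Proof.
case/andP: alpha01 => a0 a1 fb; rewrite /step.
by apply: addr_ge0; apply: mulr_ge0; rewrite ?subr_ge0 // ltW.
Qed.

Lemma iter_step_le f b n x : (forall y, f y <= b) -> iter n step f x <= b.
Proof. by move=> fb; elim: n x => //= n IH x; exact: step_le. Qed.

Lemma iter_step_ge0 f n x : (forall y, 0 <= f y) -> 0 <= iter n step f x.
Proof. by move=> fb; elim: n x => //= n IH x; exact: step_ge0. Qed.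

Lemma energy_decay d f n : (0 < d)%N -> periodic d f -> \sum_(x < d) f x = 0 ->
  \sum_(x < d) iter n step f x ^+ 2 <=
  (1 - c / d%:R ^+ 2) ^+ n * \sum_(x < d) f x ^+ 2.
Proof.
move=> d0 fd f0.
have dR : 0 < d%:R ^+ 2 :> R by rewrite exprn_gt0 // ltr0n.
have c0 := spread_gt0; have c1 := spread_le1.
have rho0 : 0 <= 1 - c / d%:R ^+ 2.
  rewrite subr_ge0 ler_pdivrMr // mul1r (le_trans c1) //.
  by rewrite -natrX ler1n expn_gt0 d0.
elim: n => [|n IH]; first by rewrite expr0 mul1r.
rewrite iterS step_energy; last exact: iter_step_periodic.
rewrite exprS -[leRHS]mulrA; apply: (le_trans _ (ler_wpM2l rho0 IH)).
rewrite mulrBl mul1r lerD2l lerN2 -[leLHS]mulrA ler_pM2l // ler_pdivrMl //.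
apply: poincare => //; first exact: iter_step_periodic.
by rewrite sum_iter_step.
Qed.

(** By [step_energy] and [poincare] each step contracts the energy by [1 - c /
    d^2], which is at most the square of the factor used here; a single value
    is at most the square root of the energy. *)
Lemma mixing d f n x : (0 < d)%N -> periodic d f -> \sum_(x < d) f x = 0 ->
  \sum_(x < d) f x ^+ 2 <= 1 ->
  `|iter n step f x| <= (1 - c / (2 * d%:R ^+ 2)) ^+ n.
Proof.
move=> d0 fd f0 f1.
have dR : 1 <= d%:R ^+ 2 :> R by rewrite -natrX ler1n expn_gt0 d0.
have c0 := spread_gt0; have c1 := spread_le1.
set t := c / (2 * d%:R ^+ 2).
have tE : c / d%:R ^+ 2 = 2 * t by rewrite /t; field; rewrite pnatr_eq0 -lt0n.
have t0 : 0 < t by rewrite divr_gt0 // mulr_gt0 //; lra.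
have t1 : 2 * t <= 1 by rewrite -tE ler_pdivrMr ?mul1r; lra.
have s0 : 0 <= 1 - t by lra.
rewrite -(ler_pXn2r (ltn0Sn 1)) ?nnegrE ?exprn_ge0 // real_normK ?num_real //.
have Fd := iter_step_periodic n fd.
have F2d : periodic d (fun x => iter n step f x ^+ 2) by move=> z; rewrite Fd.
apply: (@le_trans _ _ (\sum_(y < d) iter n step f y ^+ 2)).
  rewrite -(sum_periodic_shift x F2d).
  case: d d0 {dR tE fd f0 f1 Fd F2d t t0 t1 s0} => // d _.
  rewrite big_ord_recl /= addn0 lerDl.
  by apply: sumr_ge0 => i _; exact: sqr_ge0.
apply: le_trans (energy_decay n d0 fd f0) _; rewrite tE.
have r0 : 0 <= 1 - 2 * t by lra.
apply: (@le_trans _ _ ((1 - 2 * t) ^+ n)).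
  by rewrite -[leRHS]mulr1 ler_wpM2l // exprn_ge0.
rewrite exprAC lerXn2r ?nnegrE // ?sqr_ge0 //.
have := sqr_ge0 t; lra.
Qed.

(** The energies decrease by [c] times the Dirichlet forms, so these sum to at
    most [1 / c]; among [n] of them one is at most the average. *)
Lemma flat_iterate d f n : (0 < n)%N -> periodic d f ->
  \sum_(x < d) f x ^+ 2 <= 1 ->
  exists2 k, (k < n)%N & dirichlet_form d (iter k step f) <= (c * n%:R)^-1.
Proof.
move=> n0 fd f1.
have c0 := spread_gt0; have nR : 0 < n%:R :> R by rewrite ltr0n.
have total : c * \sum_(k < n) dirichlet_form d (iter k step f) <= 1.
  apply: (le_trans _ f1).
  suff -> : c * \sum_(k < n) dirichlet_form d (iter k step f) =
      \sum_(x < d) f x ^+ 2 - \sum_(x < d) iter n step f x ^+ 2.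
    by rewrite gerBl; apply: sumr_ge0 => i _; exact: sqr_ge0.
  elim: (n) => [|m IH]; first by rewrite big_ord0 mulr0 subrr.
  rewrite big_ord_recr /= mulrDr IH step_energy; last exact: iter_step_periodic.
  ring.
apply: contrapT => no.
have : \sum_(k < n) (c * n%:R)^-1 < \sum_(k < n) dirichlet_form d (iter k step f).
  apply: ltr_sum => [|k _]; first by apply/hasP; exists (Ordinal n0); rewrite // mem_index_enum.
  by rewrite ltNge; apply/negP => le; apply: no; exists k.
rewrite sumr_const card_ord -[ltLHS]mulr_natl => lt.
move: total; apply/negP; rewrite -ltNge -ltr_pdivrMl // mulr1.
by apply: (le_lt_trans _ lt); rewrite [(c * n%:R)^-1]invfM mulrCA mulfV ?mulr1 // gt_eqF.
Qed.

(** A Nash-type argument. At a time [k < n] where the iterate is flat, its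
    value at [y] is its average over a window of length [l], at most [1 / l]
    because the total mass is 1, plus an oscillation controlled by the
    Dirichlet form. Later steps are averages and preserve upper bounds. The
    window length [l] is left free and chosen as a function of [n] and [d]
    later. *)
Lemma anticoncentration d f n l x : (0 < n)%N -> (0 < l <= d)%N -> periodic d f ->
  (forall y, 0 <= f y) -> \sum_(x < d) f x = 1 -> \sum_(x < d) f x ^+ 2 <= 1 ->
  iter n step f x <= 3 / 2 / l%:R + l%:R ^+ 2 / (2 * (c * n%:R)).
Proof.
move=> n0 /andP[l0 ld] fd fp f1 f2.
have [k kn flat] := flat_iterate n0 fd f2.
have -> : n = ((n - k) + k)%N by rewrite subnK // ltnW.
rewrite iterD; apply: iter_step_le => y.
rewrite subnK; last exact: ltnW.
set F := iter k step f in flat *.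
have Fd : periodic d F by exact: iter_step_periodic.
have lR : 0 < l%:R :> R by rewrite ltr0n.
have cn : 0 < c * n%:R by rewrite mulr_gt0 ?ltr0n // spread_gt0.
have D0 : 0 <= dirichlet_form d F by apply: sumr_ge0 => i _; exact: sqr_ge0.
have mass : \sum_(i < l) F (y + i)%N <= 1.
  rewrite -f1 -(sum_iter_step k fd) -(sum_periodic_shift y Fd).
  rewrite -(big_mkord xpredT (fun i => F (y + i)%N)).
  rewrite -[leRHS](big_mkord xpredT (fun i => F (y + i)%N)).
  rewrite [leRHS](big_cat_nat (leq0n l) ld) /= lerDl.
  by apply: sumr_ge0 => i _; exact: iter_step_ge0.
have osc (i : 'I_l) : F y - F (y + i)%N <= (l%:R^-1 + l%:R ^+ 2 * (c * n%:R)^-1) / 2.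
  have o : (F y - F (y + i)%N) ^+ 2 <= l%:R * (c * n%:R)^-1.
    apply: le_trans (oscillation y Fd (ltnW (ltn_ord i)) ld) _.
    by rewrite ler_pM2l.
  set t := F y - _ in o *.
  have : l%:R * t ^+ 2 <= l%:R ^+ 2 * (c * n%:R)^-1.
    by rewrite [l%:R ^+ 2]expr2 -[leRHS]mulrA ler_pM2l.
  (* This square yields 2 t <= 1 / l + l t^2, a linear bound on t from the
     bound on t^2. *)
  have : 0 <= l%:R * (t - l%:R^-1) ^+ 2 by rewrite mulr_ge0 ?sqr_ge0 // ltW.
  rewrite (_ : l%:R * (t - l%:R^-1) ^+ 2 = l%:R * t ^+ 2 - 2 * t + l%:R^-1); last first.
    by field; rewrite gt_eqF.
  lra.
have : l%:R * F y <= 1 + l%:R * ((l%:R^-1 + l%:R ^+ 2 * (c * n%:R)^-1) / 2).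
  rewrite (_ : l%:R * F y = \sum_(i < l) F (y + i)%N + \sum_(i < l) (F y - F (y + i)%N)).
    apply: lerD => //.
    rewrite (_ : l%:R * _ = \sum_(i < l) ((l%:R^-1 + l%:R ^+ 2 * (c * n%:R)^-1) / 2)).
      exact: ler_sum.
    by rewrite sumr_const card_ord mulr_natl.
  by rewrite sumrB addrC subrK sumr_const card_ord mulr_natl.
rewrite -ler_pdivlMl // => h; apply: le_trans h _.
rewrite le_eqVlt; apply/orP; left; apply/eqP.
have /andP[a0 a1] := alpha01.
have lz : l%:R != 0 :> R by rewrite gt_eqF.
have nz : n%:R != 0 :> R by rewrite pnatr_eq0 -lt0n.
have az : alpha != 0 by rewrite gt_eqF.
have bz : 1 - alpha != 0 by rewrite gt_eqF // subr_gt0.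
by field; rewrite ?lz ?nz ?az ?bz.
Qed.

End Step.

(** * Means over finitely many coin flips *)

Section CoinMean.
Context {R : realType} (alpha : R).
Hypothesis alpha01 : 0 < alpha < 1.
Implicit Types (g h : seq bool -> R) (f : nat -> R).

Notation c := (alpha * (1 - alpha)).

(** The expectation of [g] over [n] independent flips of a coin of bias
    [alpha]. The last flip is averaged first, which makes the Markov property
    an induction on the number of last flips. *)
Fixpoint coin_mean n g : R :=
  if n is m.+1 then
    coin_mean m (fun s => alpha * g (rcons s true) + (1 - alpha) * g (rcons s false))
  else g [::].

Definition heads n (s : seq bool) : nat := count id (take n s).

Lemma heads_rcons s b : heads (size s).+1 (rcons s b) = (heads (size s) s + b)%N.
Proof. by rewrite /heads take_oversize ?size_rcons // take_size -cats1 count_cat /= addn0. Qed.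

Lemma eq_coin_mean n g h :
  (forall s, size s = n -> g s = h s) -> coin_mean n g = coin_mean n h.
Proof.
elim: n g h => [|n IH] g h gh /=; first exact: gh.
by apply: IH => s sn; rewrite !gh // size_rcons sn.
Qed.

Lemma coin_mean_le n g h :
  (forall s, size s = n -> g s <= h s) -> coin_mean n g <= coin_mean n h.
Proof.
have [a0 b0] : 0 <= alpha /\ 0 <= 1 - alpha.
  by case/andP: alpha01 => a0 a1; split; lra.
elim: n g h => [|n IH] g h gh /=; first exact: gh.
apply: IH => s sn; apply: lerD; apply: ler_wpM2l => //.
  by apply: gh; rewrite size_rcons sn.
by apply: gh; rewrite size_rcons sn.
Qed.

Lemma coin_meanD n g h :
  coin_mean n (fun s => g s + h s) = coin_mean n g + coin_mean n h.
Proof.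
elim: n g h => [|n IH] g h //=; rewrite -IH.
by apply: eq_coin_mean => s _; ring.
Qed.

Lemma coin_meanZ n k g : coin_mean n (fun s => k * g s) = k * coin_mean n g.
Proof.
elim: n g => [|n IH] g //=; rewrite -IH.
by apply: eq_coin_mean => s _; ring.
Qed.

Lemma coin_mean_cst n k : coin_mean n (fun=> k) = k.
Proof.
elim: n => //= n IH; rewrite -[RHS]IH.
by apply: eq_coin_mean => s _; ring.
Qed.

Lemma coin_mean_sum n (I : Type) (r : seq I) (p : pred I) (F : I -> seq bool -> R) :
  coin_mean n (fun s => \sum_(i <- r | p i) F i s) = \sum_(i <- r | p i) coin_mean n (F i).
Proof.
elim: r => [|i r IH].
  rewrite big_nil -[RHS](coin_mean_cst n 0); apply: eq_coin_mean => s _.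
  by rewrite big_nil.
rewrite big_cons -IH; case: ifP => pi; last first.
  by apply: eq_coin_mean => s _; rewrite big_cons pi.
by rewrite -coin_meanD; apply: eq_coin_mean => s _; rewrite big_cons pi.
Qed.

(** Averaging a function of the number of heads over one flip is applying
    [step] to it. *)
Lemma coin_mean_markov m k h f :
  coin_mean (m + k) (fun s => h (take m s) * f (heads (m + k) s)) =
  coin_mean m (fun s => h s * iter k (step alpha) f (heads m s)).
Proof.
elim: k f => [|k IH] f.
  by rewrite addn0; apply: eq_coin_mean => s sm /=; rewrite take_oversize ?sm.
rewrite addnS iterSr -IH /=; apply: eq_coin_mean => s sm.
have ms : (m <= size s)%N by rewrite sm leq_addr.
rewrite -!cats1 !takel_cat // !cats1 -sm !heads_rcons addn0 addn1 /step.
by ring.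
Qed.

Lemma coin_mean_take m n h : (m <= n)%N ->
  coin_mean n (fun s => h (take m s)) = coin_mean m h.
Proof.
move=> /subnKC <-.
have := coin_mean_markov m (n - m) h (fun=> 1).
under eq_coin_mean do rewrite mulr1.
move=> ->; apply: eq_coin_mean => s _.
rewrite [iter _ _ _ _](_ : _ = 1) ?mulr1 //.
elim: (n - m)%N (heads m s) => //= k IH x; rewrite /step !IH; ring.
Qed.

Lemma coin_mean_heads n m f : (m <= n)%N ->
  coin_mean n (fun s => f (heads m s)) = iter m (step alpha) f 0%N.
Proof.
move=> mn; rewrite (coin_mean_take (fun s => f (count id s)) mn).
have := coin_mean_markov 0 m (fun=> 1) f; rewrite add0n /= mul1r => <-.
by apply: eq_coin_mean => s sm; rewrite mul1r /heads take_oversize ?sm.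
Qed.

Lemma coin_mean_heads2 n m k f : (m + k <= n)%N ->
  coin_mean n (fun s => f (heads m s) * f (heads (m + k) s)) =
  coin_mean m (fun s => f (heads m s) * iter k (step alpha) f (heads m s)).
Proof.
move=> mn.
transitivity (coin_mean n (fun s => (fun u => f (heads m u) * f (heads (m + k) u)) (take (m + k) s))).
  by apply: eq_coin_mean => s _; rewrite /heads !take_takel // leq_addr.
rewrite (coin_mean_take (fun u => f (heads m u) * f (heads (m + k) u)) mn).
rewrite -(coin_mean_markov m k (fun u => f (heads m u))).
by apply: eq_coin_mean => s _; rewrite /heads take_takel.
Qed.

Lemma geometric_sum_le (q : R) n : 0 <= q < 1 ->
  \sum_(i < n) q ^+ (n - i) <= (1 - q)^-1.
Proof.
move=> /andP[q0 q1]; have p0 : 0 < 1 - q by rewrite subr_gt0.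
rewrite -[leRHS]mulr1 ler_pdivlMl //.
elim: n => [|n IH]; first by rewrite big_ord0 mulr0.
rewrite big_ord_recr /= subSnn expr1.
have -> : \sum_(i < n) q ^+ (n.+1 - i) = q * \sum_(i < n) q ^+ (n - i).
  by rewrite mulr_sumr; apply: eq_bigr => i _; rewrite subSn ?exprS // ltnW.
by move: IH; set S := \sum_(i < n) _; nra.
Qed.

(** By the Markov property the covariance of [f] at two times is bounded by
    the [mixing] rate to the power of their distance. Each new term of the sum
    thus adds to the second moment at most 1 plus twice a geometric sum. *)
Lemma variance_le d f (chi : nat -> R) N n : (0 < d)%N -> periodic d f ->
  \sum_(x < d) f x = 0 -> \sum_(x < d) f x ^+ 2 <= 1 -> (n <= N)%N ->
  (forall i, 0 <= chi i <= 1) ->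
  coin_mean N (fun s => (\sum_(i < n) chi i * f (heads i.+1 s)) ^+ 2) <=
  n%:R * (1 + 4 * d%:R ^+ 2 / c).
Proof.
move=> d0 fd f0 f1 nN chi01.
have dR : 1 <= d%:R ^+ 2 :> R by rewrite -natrX ler1n expn_gt0 d0.
have dz : d%:R != 0 :> R by rewrite pnatr_eq0 -lt0n.
have c0 := spread_gt0 alpha01; have c1 := spread_le1 alpha01.
have mix k x := mixing alpha01 k x d0 fd f0 f1.
have fle x : `|f x| <= 1 by have := mix 0%N x; rewrite expr0.
set q := 1 - c / (2 * d%:R ^+ 2) in mix.
have q01 : 0 <= q < 1.
  rewrite /q subr_ge0 gtrBl; apply/andP; split; last by rewrite divr_gt0 // mulr_gt0 //; lra.
  by rewrite ler_pdivrMr ?mul1r; lra.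
have qE : (1 - q)^-1 = 2 * d%:R ^+ 2 / c.
  by rewrite /q opprB addrC subrK invf_div.
have cov i k : (i + k <= N)%N ->
    coin_mean N (fun s => f (heads i s) * f (heads (i + k) s)) <= q ^+ k.
  move=> ikN; rewrite coin_mean_heads2 // -[leRHS](coin_mean_cst i).
  apply: coin_mean_le => s _; apply: le_trans (ler_norm _) _.
  by rewrite normrM -[leRHS]mul1r ler_pM.
elim: n nN => [|n IH] nN.
  rewrite mul0r [leLHS](_ : _ = 0) // -[RHS](coin_mean_cst N).
  by apply: eq_coin_mean => s _; rewrite big_ord0 expr0n.
pose S s := \sum_(i < n) chi i * f (heads i.+1 s).
apply: (@le_trans _ _ (coin_mean N (fun s => (S s) ^+ 2 +
   (\sum_(i < n) (2 * (chi i * chi n)) * (f (heads i.+1 s) * f (heads n.+1 s)) + 1)))).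
  apply: coin_mean_le => s _; rewrite big_ord_recr /= -/(S s).
  have -> : \sum_(i < n) (2 * (chi i * chi n)) * (f (heads i.+1 s) * f (heads n.+1 s)) =
     S s * (2 * (chi n * f (heads n.+1 s))).
    by rewrite mulr_suml; apply: eq_bigr => i _; ring.
  rewrite sqrrD -mulrnAr -mulr_natl -addrA lerD2l lerD2l.
  have /andP[h0 h1] := chi01 n.
  rewrite exprMn mulr_ile1 ?sqr_ge0 //; first by rewrite expr_le1.
  by rewrite -real_normK ?num_real // expr_le1.
rewrite !coin_meanD coin_mean_cst coin_mean_sum -natr1.
apply: (@le_trans _ _ (n%:R * (1 + 4 * d%:R ^+ 2 / c) + (\sum_(i < n) 2 * q ^+ (n - i) + 1))).
  apply: lerD; first exact: IH (ltnW nN).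
  rewrite lerD2r; apply: ler_sum => i _; rewrite coin_meanZ.
  have /andP[h0 h1] := chi01 n; have /andP[h2 h3] := chi01 i.
  rewrite -mulrA ler_pM2l //.
  have -> : n.+1 = (i.+1 + (n - i))%N by rewrite addSn subnKC // ltnW.
  have qp : 0 <= q ^+ (n - i) by case/andP: q01 => q0 _; exact: exprn_ge0.
  have cv : coin_mean N (fun s => f (heads i.+1 s) * f (heads (i.+1 + (n - i))%N s)) <= q ^+ (n - i).
    by apply: cov; rewrite addSn subnKC // ltnW.
  apply: (@le_trans _ _ (chi i * chi n * q ^+ (n - i))).
    by rewrite ler_wpM2l // mulr_ge0.
  by rewrite ler_piMl // mulr_ile1.
rewrite -mulr_sumr.
have := geometric_sum_le n q01; rewrite qE => G.
have -> : 4 * d%:R ^+ 2 / c = 2 * (2 * d%:R ^+ 2 / c) by ring.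
by move: G; set Y := 2 * d%:R ^+ 2 / c; set S' := \sum_(i < n) _; lra.
Qed.

End CoinMean.

(** * First moment of the sieve error *)

Section Freq.
Context {R : realType}.

Definition freq N (p : pred nat) (g : nat -> nat) : R :=
  N%:R^-1 * \sum_(i < N) (p (g i.+1))%:R.

(** The scale [j] looks at the first [N = j^12] terms and at the divisors up
    to [j^2]. The range of divisors makes the part of large gcds, of order [1
    / j^2], summable in [j]; the exponent of [N] leaves room for the
    variances, which are polynomial in [d]. *)
Definition sieve_error j (g : nat -> nat) : R :=
  \sum_(d < j ^ 2) `|freq (j ^ 12) (fun m => d.+1 %| m)%N g - (d.+1%:R ^+ 2)^-1|
  + freq (j ^ 12) (fun m => j ^ 2 < m)%N g.

Lemma count_multiples d t N : (0 < d)%N ->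
  (\sum_(i < N) (d %| t + i.+1) + t %/ d = (t + N) %/ d)%N.
Proof.
move=> d0; elim: N => [|N IH]; first by rewrite big_ord0 addn0.
by rewrite big_ord_recr /= addnAC IH addnS divnS // addnC.
Qed.

Lemma count_below_le N K : (\sum_(i < N) (i < K) <= K)%N.
Proof.
suff -> : (\sum_(i < N) (i < K) = minn N K)%N by exact: geq_minr.
elim: N => [|N IH]; first by rewrite big_ord0 min0n.
by rewrite big_ord_recr /= IH; case: ltnP => h /=; lia.
Qed.

Lemma divn_bounds m d : (0 < d)%N ->
  (m %/ d)%:R <= m%:R / d%:R :> R /\ m%:R / d%:R < (m %/ d)%:R + 1 :> R.
Proof.
move=> d0; have dR : 0 < d%:R :> R by rewrite ltr0n.
rewrite ler_pdivlMr // ltr_pdivrMr // natr1 -!natrM ler_nat ltr_nat.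
by rewrite leq_trunc_div ltn_ceil.
Qed.

Lemma count_multiples_approx d t N : (0 < d)%N ->
  `|\sum_(i < N) (d %| t + i.+1)%N%:R - N%:R / d%:R| <= 1 :> R.
Proof.
move=> d0; have := congr1 (fun m => m%:R : R) (count_multiples t N d0).
rewrite natrD natr_sum => e.
have [a1 a2] := divn_bounds t d0; have [b1 b2] := divn_bounds (t + N) d0.
move: b1 b2; rewrite natrD mulrDl -e => b1 b2.
by rewrite ler_norml; apply/andP; split; lra.
Qed.

Lemma count_multiples_le d t N : (0 < d)%N ->
  \sum_(i < N) (d %| t + i.+1)%N%:R <= (t + N)%:R / d%:R :> R.
Proof.
move=> d0; have := congr1 (fun m => m%:R : R) (count_multiples t N d0).
rewrite natrD natr_sum => e.
have [b1 b2] := divn_bounds (t + N) d0.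
by have := ler0n R (t %/ d)%N; lra.
Qed.

(** Each term [1 / n] is at most [ln n - ln (n - 1)], by [ln (1 + x) <= x] at
    [x = - 1 / n]. *)
Lemma harmonic_le M : (0 < M)%N -> \sum_(i < M) (i.+1%:R)^-1 <= 1 + ln M%:R :> R.
Proof.
elim: M => // -[|M] IH _; first by rewrite big_ord_recr big_ord0 /= ln1 add0r addr0 invr1.
rewrite big_ord_recr /=; apply: le_trans (lerD (IH isT) (lexx _)) _.
rewrite -addrA lerD2l.
have M1 : 0 < M.+1%:R :> R by rewrite ltr0n.
have M2 : 0 < M.+2%:R :> R by rewrite ltr0n.
have e : M.+1%:R = M.+2%:R * (1 + - (M.+2%:R)^-1) :> R.
  by rewrite mulrDr mulrN mulfV ?gt_eqF // mulr1 -[M.+2%:R]natr1 addrK.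
have lt1 : - 1 < - (M.+2%:R)^-1 :> R.
  by rewrite ltrN2 invf_lt1 // ltr1n.
have p : 0 < 1 + - (M.+2%:R)^-1 :> R by rewrite -[ltLHS](subrr 1) ltrD2l.
have := le_ln1Dx lt1.
have -> : ln M.+1%:R = ln M.+2%:R + ln (1 + - (M.+2%:R)^-1) :> R.
  by rewrite e lnM // posrE.
set u := ln M.+2%:R; set v := ln _; set z := M.+2%:R^-1; lra.
Qed.

(** Comparison with the telescoping sum of [1 / i - 1 / (i + 1)]. *)
Lemma inv_square_tail y M : (0 < y)%N ->
  \sum_(i < M | (y < i.+1)%N) (i.+1%:R ^+ 2)^-1 <= y%:R^-1 :> R.
Proof.
move=> y0.
suff: \sum_(i < M | (y < i.+1)%N) (i.+1%:R ^+ 2)^-1 <= y%:R^-1 - (maxn y M)%:R^-1 :> R.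
  move=> h; apply: le_trans h _; rewrite gerBl invr_ge0.
  exact: ler0n.
elim: M => [|M IH]; first by rewrite big_ord0 maxn0 subrr.
rewrite big_mkcond big_ord_recr -big_mkcond /=.
case: ltnP => [yM|My]; last first.
  by rewrite addr0; move: IH; rewrite (maxn_idPl (ltnW My)).
rewrite (maxn_idPr (yM : (y <= M)%N)) in IH.
have M0 : (0 < M)%N by apply: leq_trans y0 _.
have MR : 0 < M%:R :> R by rewrite ltr0n.
have SR : 0 < M.+1%:R :> R by rewrite ltr0n.
have : (M.+1%:R ^+ 2)^-1 <= M%:R^-1 - M.+1%:R^-1 :> R.
  have -> : M%:R^-1 - M.+1%:R^-1 = (M%:R * M.+1%:R)^-1 :> R.
    by rewrite -natr1; field; rewrite natr1 !gt_eqF.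
  rewrite lef_pV2 ?posrE ?mulr_gt0 // ?exprn_gt0 //.
  by rewrite expr2 ler_pM2r // ler_nat.
by move=> h; apply: le_trans (lerD IH h) _; rewrite addrA subrK.
Qed.

End Freq.

Section GcdError.
Context {R : realType} (alpha : R).
Hypothesis alpha01 : 0 < alpha < 1.
Variables (a t : nat).
Notation c := (alpha * (1 - alpha)).
Notation mean := (coin_mean alpha).

Definition residue d x : R := (d %| a + x)%N%:R.

(** The gcd of the position after [n] steps: [gcd (x, y) = gcd (x, x + y)],
    and the coordinates of a walk from [(a, b)] add up to [t + n] with [t = a
    + b]. *)
Definition walk_gcd (s : seq bool) n : nat := gcdn (a + heads n s) (t + n).

Lemma residue_periodic d : periodic d (residue d).
Proof. by move=> x; rewrite /residue addnA dvdn_addl. Qed.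

Lemma residue01 d x : 0 <= residue d x <= 1.
Proof. by rewrite /residue; case: (_ %| _)%N; rewrite ?lexx ler01. Qed.

Lemma sum_residue d : (0 < d)%N -> \sum_(x < d) residue d x = 1.
Proof.
move=> d0.
have pd : periodic d (fun x => (d %| x)%N%:R : R) by move=> x; rewrite dvdn_addl.
rewrite (sum_periodic_shift a pd); case: d d0 {pd} => // d _.
rewrite big_ord_recl big1 ?addr0 ?dvdn0 // => i _.
by rewrite gtnNdvd //= /bump leq0n add1n ltnS.
Qed.

Lemma sum_residue2 d : (0 < d)%N -> \sum_(x < d) residue d x ^+ 2 = 1.
Proof.
move=> d0; rewrite -[RHS](sum_residue d0); apply: eq_bigr => x _.
by rewrite /residue; case: (_ %| _)%N; rewrite ?expr1n ?expr0n.
Qed.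

Definition deviation d x : R := residue d x - d%:R^-1.

Lemma deviation_periodic d : periodic d (deviation d).
Proof. by move=> x; rewrite /deviation residue_periodic. Qed.

Lemma sum_deviation d : (0 < d)%N -> \sum_(x < d) deviation d x = 0.
Proof.
move=> d0; rewrite sumrB sum_residue // sumr_const card_ord -[_ *+ d]mulr_natl mulfV ?subrr //.
by rewrite pnatr_eq0 -lt0n.
Qed.

Lemma sum_deviation2 d : (0 < d)%N -> \sum_(x < d) deviation d x ^+ 2 <= 1.
Proof.
move=> d0; have dz : d%:R != 0 :> R by rewrite pnatr_eq0 -lt0n.
have -> : \sum_(x < d) deviation d x ^+ 2 =
   \sum_(x < d) residue d x ^+ 2 - d%:R^-1 * \sum_(x < d) (residue d x + deviation d x).
  by rewrite mulr_sumr -sumrB; apply: eq_bigr => x _; rewrite /deviation; ring.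
by rewrite big_split /= sum_residue // sum_residue2 // sum_deviation // gerBl addr0 mulr1.
Qed.

Lemma divides_walk_gcd d s n :
  (d %| walk_gcd s n)%N%:R = (d %| t + n)%N%:R * residue d (heads n s) :> R.
Proof. by rewrite /walk_gcd /residue dvdn_gcd -natrM mulnb andbC. Qed.

(** The frequency differs from [1 / d^2] by a deterministic term, the count of
    the [n] with [d] dividing [t + n], and by a centred sum whose second
    moment is bounded by [variance_le]. The parameter [lam] of [|x| <= (lam +
    x^2 / lam) / 2] replaces a square root. *)
Lemma mean_freq_error d N (lam : R) : (0 < d)%N -> (0 < N)%N -> 0 < lam ->
  mean N (fun s => `|freq N (fun m => d %| m)%N (walk_gcd s) - (d%:R ^+ 2)^-1|) <=
  (d%:R * N%:R)^-1 + (lam + (1 + 4 * d%:R ^+ 2 / c) / (N%:R * lam)) / 2.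
Proof.
move=> d0 N0 l0.
have dR : 0 < d%:R :> R by rewrite ltr0n.
have NR : 0 < N%:R :> R by rewrite ltr0n.
pose chi i : R := (d %| t + i.+1)%N%:R.
pose S s := \sum_(i < N) chi i * deviation d (heads i.+1 s).
have split_ s : `|freq N (fun m => d %| m)%N (walk_gcd s) - (d%:R ^+ 2)^-1| <=
    (d%:R * N%:R)^-1 + (lam / 2 + (2 * lam * N%:R ^+ 2)^-1 * S s ^+ 2).
  have -> : freq N (fun m => d %| m)%N (walk_gcd s) - (d%:R ^+ 2)^-1 =
     (d%:R * N%:R)^-1 * (\sum_(i < N) (d %| t + i.+1)%N%:R - N%:R / d%:R) + N%:R^-1 * S s.
    rewrite /freq.
    have -> : \sum_(i < N) (d %| walk_gcd s i.+1)%N%:R =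
       S s + d%:R^-1 * \sum_(i < N) (d %| t + i.+1)%N%:R :> R.
      rewrite mulr_sumr -big_split; apply: eq_bigr => i _ /=.
      by rewrite divides_walk_gcd /chi /deviation; ring.
    by field; rewrite !gt_eqF.
  apply: le_trans (ler_normD _ _) _; apply: lerD.
    have k0 : 0 <= (d%:R * N%:R)^-1 :> R by rewrite invr_ge0 mulr_ge0.
    rewrite normrM ger0_norm // -[leRHS]mulr1 ler_wpM2l //.
    exact: count_multiples_approx.
  have -> : (2 * lam * N%:R ^+ 2)^-1 * S s ^+ 2 = (2 * lam)^-1 * `|N%:R^-1 * S s| ^+ 2.
    by rewrite real_normK ?num_real //; field; rewrite !gt_eqF.
  set X := `|_|.
  (* |x| <= (lam + x^2 / lam) / 2, as a square. *)
  rewrite -subr_ge0 [X in 0 <= X](_ : _ = (2 * lam)^-1 * (X - lam) ^+ 2).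
    by rewrite mulr_ge0 ?sqr_ge0 // invr_ge0 mulr_ge0 // ltW.
  by field; rewrite gt_eqF.
apply: le_trans (coin_mean_le alpha01 (fun s _ => split_ s)) _.
rewrite !coin_meanD !coin_mean_cst coin_meanZ lerD2l [leRHS]mulrDl lerD2l.
have V : mean N (fun s => S s ^+ 2) <= N%:R * (1 + 4 * d%:R ^+ 2 / c).
  apply: (variance_le alpha01 d0 (@deviation_periodic d)) => //.
  - exact: sum_deviation.
  - exact: sum_deviation2.
  - by move=> i; rewrite /chi; case: (_ %| _)%N; rewrite ?lexx ler01.
have kp : 0 <= (2 * lam * N%:R ^+ 2)^-1.
  by rewrite invr_ge0 !mulr_ge0 ?sqr_ge0 // ltW.
apply: le_trans (ler_wpM2l kp V) _.
rewrite le_eqVlt; apply/orP; left; apply/eqP.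
set Y := 1 + _; field; rewrite !gt_eqF //.
Qed.

(** [anticoncentration] with a window of length [l], or of the whole cycle
    when [d < l]. *)
Lemma mean_residue_le d l n N : (0 < n <= N)%N -> (0 < d)%N -> (0 < l)%N ->
  mean N (fun s => residue d (heads n s)) <=
  3 / (2 * d%:R) + 3 / (2 * l%:R) + l%:R ^+ 2 / (2 * (c * n%:R)).
Proof.
move=> /andP[n0 nN] d0 l0.
have c0 := spread_gt0 alpha01.
rewrite coin_mean_heads //.
have ml : (0 < minn l d <= d)%N by rewrite leq_min l0 d0 geq_minr.
apply: le_trans (anticoncentration alpha01 0 n0 ml (@residue_periodic d) _ (sum_residue d0) _) _.
- by move=> y; case/andP: (residue01 d y).
- by rewrite sum_residue2.
have nR : 0 < n%:R :> R by rewrite ltr0n.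
apply: lerD.
  rewrite !invfM !mulrA; case: (leqP l d) => _; [rewrite lerDr|rewrite lerDl];
  by rewrite !mulr_ge0 ?invr_ge0 ?ler0n.
apply: ler_wpM2r; first by rewrite invr_ge0 mulr_ge0 // mulr_ge0 // ltW.
by rewrite -!natrX ler_nat leq_exp2r // geq_minl.
Qed.

(** Union bound over the value of the gcd. *)
Lemma large_gcd_le y n M s : (0 < t + n <= M)%N ->
  (y < walk_gcd s n)%:R <=
  \sum_(d < M | (y < d.+1)%N) (d.+1 %| t + n)%N%:R * residue d.+1 (heads n s) :> R.
Proof.
move=> /andP[tn tM]; case: ltnP => [yg|_]; last first.
  by apply: sumr_ge0 => d _; rewrite mulr_ge0 ?ler0n.
have gp : (0 < walk_gcd s n)%N by rewrite gcdn_gt0 tn orbT.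
have gle : ((walk_gcd s n).-1 < M)%N.
  by rewrite prednK //; apply: leq_trans tM; rewrite dvdn_leq // dvdn_gcdr.
rewrite (bigD1 (Ordinal gle)) /= ?prednK //.
rewrite -divides_walk_gcd dvdnn lerDl.
by apply: sumr_ge0 => d _; rewrite mulr_ge0 ?ler0n.
Qed.

(** The times up to [K] are counted trivially. After [K], the union bound
    leaves the sum over [d] of the number of multiples of [d], about [(t + N)
    / d], times the probability of a residue class; the part [1 / d] of that
    probability gives a tail of the sum of [1 / d^2], the remaining part a
    harmonic sum. *)
Lemma mean_large_gcd y l K N : (0 < y)%N -> (0 < l)%N -> (0 < K)%N -> (0 < N)%N ->
  mean N (fun s => freq N (fun m => y < m)%N (walk_gcd s)) <=
  K%:R / N%:R + (t + N)%:R / N%:R *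
    (3 / (2 * y%:R) + (1 + ln (t + N)%:R) * (3 / (2 * l%:R) + l%:R ^+ 2 / (2 * (c * K%:R)))).
Proof.
move=> y0 l0 K0 N0.
have c0 := spread_gt0 alpha01.
have NR : 0 < N%:R :> R by rewrite ltr0n.
have KR : 0 < K%:R :> R by rewrite ltr0n.
have lR : 0 < l%:R :> R by rewrite ltr0n.
set W := 3 / (2 * l%:R) + l%:R ^+ 2 / (2 * (c * K%:R)).
have cK : 0 <= c * K%:R by rewrite mulr_ge0 // ltW.
have W0 : 0 <= W by apply: addr_ge0; apply: divr_ge0 => //; exact: mulr_ge0.
set Z := _ + _ * W.
have -> : K%:R / N%:R + (t + N)%:R / N%:R * Z = N%:R^-1 * (K%:R + (t + N)%:R * Z).
  by rewrite [RHS]mulrDr [in RHS]mulrA ![N%:R^-1 * _]mulrC.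
rewrite /freq coin_meanZ ler_pM2l ?invr_gt0 // /Z.
rewrite coin_mean_sum.
pose B d : R := 3 / (2 * d.+1%:R) + W.
have B0 d : 0 <= B d by apply: addr_ge0 => //; apply: divr_ge0 => //; exact: mulr_ge0.
have term (i : 'I_N) : mean N (fun s => (y < walk_gcd s i.+1)%:R) <=
   (i < K)%:R + \sum_(d < t + N | (y < d.+1)%N) (d.+1 %| t + i.+1)%N%:R * B d.
  have sum0 : 0 <= \sum_(d < t + N | (y < d.+1)%N) (d.+1 %| t + i.+1)%N%:R * B d.
    by apply: sumr_ge0 => d _; rewrite mulr_ge0.
  have [iK|Ki] := ltnP i K.
    rewrite -[leLHS]addr0 lerD // -[leRHS](coin_mean_cst alpha N).
    by apply: coin_mean_le => // s _; rewrite lern1; case: (_ < _)%N.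
  rewrite add0r.
  have tn : (0 < t + i.+1 <= t + N)%N by rewrite leq_add2l ltn_ord addnS.
  apply: le_trans (coin_mean_le alpha01 (fun s _ => large_gcd_le y s tn)) _.
  rewrite coin_mean_sum.
  apply: ler_sum => d _; rewrite coin_meanZ ler_wpM2l //.
  have iN : (0 < i.+1 <= N)%N by rewrite ltn_ord.
  apply: le_trans (mean_residue_le iN (ltn0Sn d) l0) _.
  rewrite -addrA lerD2l lerD2l ler_wpM2l ?sqr_ge0 //.
  have ciR (m : nat) : (0 < m)%N -> 0 < 2 * (c * m%:R) by move=> m0; rewrite mulr_gt0 // mulr_gt0 // ltr0n.
  rewrite lef_pV2 ?posrE ?ciR // ler_pM2l // ler_pM2l // ler_nat.
  exact: leqW.
apply: le_trans (ler_sum _ (fun i _ => term i)) _.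
rewrite big_split /= lerD //.
  by rewrite -natr_sum ler_nat count_below_le.
rewrite exchange_big /=.
apply: (@le_trans _ _ (\sum_(d < t + N | (y < d.+1)%N) (t + N)%:R / d.+1%:R * B d)).
  apply: ler_sum => d _; rewrite -mulr_suml ler_wpM2r //.
  exact: count_multiples_le.
rewrite [leLHS](_ : _ = (t + N)%:R * (3 / 2 * \sum_(d < t + N | (y < d.+1)%N) (d.+1%:R ^+ 2)^-1 +
   W * \sum_(d < t + N | (y < d.+1)%N) d.+1%:R^-1)); last first.
  rewrite mulrDr !mulr_sumr -big_split; apply: eq_bigr => d _ /=.
  by rewrite /B; field; rewrite nat1r pnatr_eq0.
rewrite ler_wpM2l // lerD //.
  by rewrite invfM mulrA ler_wpM2l // ?inv_square_tail // divr_ge0.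
rewrite mulrC ler_wpM2r //.
have tN0 : (0 < t + N)%N by rewrite addn_gt0 N0 orbT.
apply: le_trans (harmonic_le tN0).
rewrite [leRHS](bigID (fun d : 'I_(t + N) => (y < d.+1)%N)) /= lerDl.
by apply: sumr_ge0 => d _; rewrite invr_ge0.
Qed.

(** The free parameters are [lam = 1 / j^4] in [mean_freq_error], and the
    window [l = j^3] and the cut-off [K = j^10] in [mean_large_gcd]; the
    logarithm is bounded by a multiple of [j]. *)
Lemma mean_sieve_error : exists C : R, forall j, (0 < j)%N ->
  mean (j ^ 12) (fun s => sieve_error j (walk_gcd s)) <= C / j%:R ^+ 2.
Proof.
have c0 := spread_gt0 alpha01; have c1 := spread_le1 alpha01.
exists (5 + 5 / c + (t.+1%:R) * (3 + (13 + t%:R) * (3 + 1 / c))) => j j0.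
set x : R := j%:R.
have x1 : 1 <= x by rewrite ler1n.
have x0 : 0 < x by lra.
have xz : x != 0 by rewrite gt_eqF.
have cz : c != 0 by rewrite gt_eqF.
have /norP[az bz] : ~~ ((alpha == 0) || (1 - alpha == 0)) by rewrite -mulf_eq0.
have jk k : (j ^ k)%:R = x ^+ k :> R by rewrite natrX.
have jp k : (0 < j ^ k)%N by rewrite expn_gt0 j0.
rewrite [leRHS]mulrDl coin_meanD; apply: lerD.
  rewrite coin_mean_sum.
  apply: (@le_trans _ _ (\sum_(d < j ^ 2) (5 + 5 / c) / x ^+ 4)); last first.
    rewrite sumr_const card_ord -[_ *+ _]mulr_natl jk le_eqVlt; apply/orP; left; apply/eqP.
    set Y := 5 + _; by field.
  apply: ler_sum => d _.
  have l0 : 0 < (x ^+ 4)^-1 by rewrite invr_gt0 exprn_gt0.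
  apply: le_trans (mean_freq_error (ltn0Sn d) (jp 12) l0) _.
  have d1 : 1 <= d.+1%:R :> R by rewrite ler1n.
  have d2 : d.+1%:R <= x ^+ 2 by rewrite -jk ler_nat.
  have A : (d.+1%:R * (j ^ 12)%:R)^-1 <= (x ^+ 4)^-1.
    have p1 : 0 < d.+1%:R * x ^+ 12 by rewrite mulr_gt0 ?exprn_gt0 // ltr0n.
    rewrite jk lef_pV2 ?posrE // ?exprn_gt0 //.
    apply: (@le_trans _ _ (x ^+ 12)); first by rewrite ler_weXn2l.
    by rewrite ler_peMl // exprn_ge0 // ltW.
  have B : (1 + 4 * d.+1%:R ^+ 2 / c) / ((j ^ 12)%:R * (x ^+ 4)^-1) <= 5 / c / x ^+ 4.
    rewrite ler_pdivrMr ?mulr_gt0 ?jk ?exprn_gt0 //.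
    have -> : 5 / c / x ^+ 4 * (x ^+ 12 * (x ^+ 4)^-1) = 5 * x ^+ 4 / c by field; rewrite xz bz az.
    have D : d.+1%:R ^+ 2 <= x ^+ 4.
      by rewrite -[4%N]/(2 * 2)%N exprM lerXn2r ?nnegrE ?sqr_ge0 //.
    rewrite ler_pdivlMr // mulrDl mul1r divfK //.
    have : 1 <= x ^+ 4 by rewrite exprn_ege1.
    lra.
  rewrite [leRHS]mulrDl; move: A B; set a1 := (_ * (j ^ 12)%:R)^-1; set b1 := _ / (_ * _); set b2 := 5 / c / _.
  set z := (x ^+ 4)^-1; move=> A B.
  have b20 : 0 <= b2 by rewrite !divr_ge0 ?exprn_ge0 // ltW.
  by have : 0 < z by []; lra.
apply: le_trans (mean_large_gcd (jp 2) (jp 3) (jp 10) (jp 12)) _.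
set w := (x ^+ 2)^-1; have w0 : 0 < w by rewrite invr_gt0 exprn_gt0.
have t0 : 0 <= t%:R :> R by [].
set q := c^-1; have q0 : 0 < q by rewrite invr_gt0.
have E1 : (j ^ 10)%:R / (j ^ 12)%:R = w by rewrite !jk /w; field.
have E2 : (t + j ^ 12)%:R / (j ^ 12)%:R <= t.+1%:R :> R.
  rewrite natrD jk ler_pdivrMr ?exprn_gt0 // -natr1 mulrDl mul1r lerD2r.
  by rewrite ler_peMr // exprn_ege1.
have E3 : 3 / (2 * (j ^ 2)%:R) = 3 / 2 * w by rewrite jk /w; field.
have E4 : 1 + ln (t + j ^ 12)%:R <= (13 + t%:R) * x.
  have lnx : ln x <= x.
    have x1' : - 1 < x - 1 by lra.
    by have := le_ln1Dx x1'; rewrite (_ : 1 + (x - 1) = x); [lra | ring].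
  have lnt : ln t.+1%:R <= t%:R :> R.
    have := @le_ln1Dx R t%:R; rewrite nat1r; apply.
    by apply: lt_le_trans t0; rewrite ltrN10.
  have le1 : (t + j ^ 12)%:R <= t.+1%:R * x ^+ 12.
    rewrite natrD jk -natr1 mulrDl mul1r lerD2r.
    by rewrite ler_peMr // exprn_ege1.
  have le2 : ln (t + j ^ 12)%:R <= ln t.+1%:R + ln x *+ 12.
    rewrite -lnXn // -lnM ?posrE ?exprn_gt0 ?ltr0n //.
    rewrite ler_ln ?posrE ?mulr_gt0 ?exprn_gt0 ?ltr0n //.
    by rewrite addn_gt0 jp orbT.
  move: le2; rewrite -[_ *+ 12]mulr_natl; nra.
have E5 : 3 / (2 * (j ^ 3)%:R) + (j ^ 3)%:R ^+ 2 / (2 * (c * (j ^ 10)%:R)) <=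
    (3 / 2 + 1 / 2 * q) / x ^+ 3.
  rewrite !jk [leRHS]mulrDl.
  have -> : 3 / (2 * x ^+ 3) = 3 / 2 / x ^+ 3 by field.
  have -> : (x ^+ 3) ^+ 2 / (2 * (c * x ^+ 10)) = 1 / 2 * q / x ^+ 4.
    by rewrite /q; field; rewrite xz bz az.
  rewrite lerD2l; apply: ler_wpM2l; first by lra.
  by rewrite lef_pV2 ?posrE ?exprn_gt0 // ler_weXn2l.
rewrite E1 E3.
have P1 : (1 + ln (t + j ^ 12)%:R) *
   (3 / (2 * (j ^ 3)%:R) + (j ^ 3)%:R ^+ 2 / (2 * (c * (j ^ 10)%:R))) <=
   (13 + t%:R) * (3 / 2 + 1 / 2 * q) * w.
  have -> : (13 + t%:R) * (3 / 2 + 1 / 2 * q) * w =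
    ((13 + t%:R) * x) * ((3 / 2 + 1 / 2 * q) / x ^+ 3) by rewrite /w; field.
  apply: ler_pM => //.
    by rewrite addr_ge0 // ln_ge0 // ler1n addn_gt0 jp orbT.
  by apply: addr_ge0; apply: divr_ge0 => //; rewrite mulr_ge0 // mulr_ge0 // ltW.
have P2 : 0 <= (13 + t%:R) * (3 / 2 + 1 / 2 * q) * w.
  by rewrite !mulr_ge0 // ?addr_ge0 ?mulr_ge0 // ltW.
apply: (@le_trans _ _ (w + t.+1%:R * (3 / 2 * w + (13 + t%:R) * (3 / 2 + 1 / 2 * q) * w))).
  rewrite lerD2l; apply: (@le_trans _ _ ((t + j ^ 12)%:R / (j ^ 12)%:R * (3 / 2 * w + (13 + t%:R) * (3 / 2 + 1 / 2 * q) * w))).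
    by apply: ler_wpM2l; rewrite ?divr_ge0 // lerD2l.
  by apply: ler_wpM2r => //; lra.
rewrite -natr1 (_ : 1 / c = q); last by rewrite mul1r.
set Y := (13 + t%:R) * (3 / 2 + 1 / 2 * q) in P1 P2 *.
have -> : (13 + t%:R) * (3 + q) = 2 * Y by rewrite /Y; field.
have : 0 <= t%:R * w by rewrite mulr_ge0 // ltW.
have : 0 <= t%:R * (Y * w) by rewrite mulr_ge0.
have -> : (t%:R + 1) * (3 + 2 * Y) / x ^+ 2 = (t%:R + 1) * (3 + 2 * Y) * w by [].
nra.
Qed.

End GcdError.

(** * From the sieve error to the frequency of each gcd *)

(** [k] divides [m] and no prime up to [r] divides [m / k], phrased by
    divisibility only so that it becomes a combination of frequencies of
    multiples. *)
Fixpoint rough r k m : bool :=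
  if r is r'.+1 then rough r' k m && (prime r ==> ~~ (k * r %| m)%N) else (k %| m)%N.

Lemma roughP r k m :
  reflect ((k %| m)%N /\ forall p, (p <= r)%N -> prime p -> ~~ (k * p %| m)%N) (rough r k m).
Proof.
elim: r => [|r IH] /=.
  apply: (iffP idP) => [km|[]//]; split => // p.
  by rewrite leqn0 => /eqP ->.
apply: (iffP andP) => [[/IH[km h] /implyP hr]|[km h]].
  split => // p; rewrite leq_eqVlt => /orP[/eqP -> |]; first exact: hr.
  exact: h.
split; last by apply/implyP; exact: h.
by apply/IH; split => // p pr; apply: h; exact: leqW.
Qed.

(** The recursion step of the sieve (Legendre): among the multiples counted at
    level [r], those removed by the prime [r + 1] are the ones counted at
    level [r] for [k (r + 1)]. *)
Lemma rough_prime r k m : prime r.+1 -> (0 < k)%N ->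
  rough r (k * r.+1) m = rough r k m && (k * r.+1 %| m)%N.
Proof.
move=> pr k0.
have key q : (q <= r)%N -> prime q -> (k * r.+1 %| m)%N ->
    (k * r.+1 * q %| m)%N = (k * q %| m)%N.
  move=> qr pq /dvdnP[m' ->].
  have cop : coprime q r.+1 by rewrite prime_coprime // dvdn_prime2 // ltn_eqF // ltnS.
  rewrite mulnCA -mulnA !dvdn_pmul2l // [(r.+1 * q)%N]mulnC dvdn_pmul2r //.
  by rewrite Gauss_dvdl.
apply/roughP/andP => [[km h]|[/roughP[km h] kpm]].
  split=> //; apply/roughP; split; first exact: dvdn_trans (dvdn_mulr _ (dvdnn k)) km.
  by move=> p pr' pp; rewrite -key //; exact: h.
by split => // p pr' pp; rewrite key //; exact: h.
Qed.

Lemma rough_self r k : (0 < k)%N -> rough r k k.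
Proof.
move=> k0; apply/roughP; split => // p _ pp; rewrite gtnNdvd //.
by rewrite ltn_Pmulr // prime_gt1.
Qed.

(** A proper multiple of [k] that survives the sieve has a quotient with a
    prime factor above [r]. *)
Lemma rough_large r k m : (0 < m)%N -> rough r k m -> m != k -> (r < m)%N.
Proof.
move=> m0 /roughP[/dvdnP[q mE] h] mk; rewrite mE in m0 mk h *.
move: m0; rewrite muln_gt0 => /andP[q0 k0].
have q1 : (1 < q)%N.
  by rewrite ltn_neqAle q0 andbT; apply: contra mk => /eqP <-; rewrite mul1n.
rewrite ltnNge; apply/negP => le.
have pq : (pdiv q <= r)%N.
  apply: leq_trans le; apply: leq_trans (pdiv_leq q0) _.
  by rewrite leq_pmulr.
have /negP := h _ pq (pdiv_prime q1); apply.
by rewrite mulnC dvdn_pmul2r // pdiv_dvd.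
Qed.

Section Sieve.
Context {R : realType} (g : nat -> nat).
Hypothesis g_gt0 : forall n, (0 < g n)%N.
Implicit Types (p q : pred nat) (N j k r : nat).

Notation err j := (@sieve_error R j g).

Lemma freq_le N p q : (forall m, (0 < m)%N -> p m -> q m) -> freq N p g <= freq N q g :> R.
Proof.
move=> pq; rewrite /freq ler_wpM2l ?invr_ge0 //; apply: ler_sum => i _.
by rewrite ler_nat; case: (p _) (pq _ (g_gt0 i.+1)) => // ->.
Qed.

Lemma freq_ge0 N p : 0 <= freq N p g :> R.
Proof. by rewrite /freq mulr_ge0 ?invr_ge0 // sumr_ge0. Qed.

Lemma err_ge0 j : 0 <= err j.
Proof. by rewrite /sieve_error addr_ge0 ?freq_ge0 // sumr_ge0. Qed.

Lemma freq_sum_le (I : Type) (s : seq I) (P : pred I) N p (q : I -> pred nat) q0 :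
  (forall m, (0 < m)%N -> (p m)%:R <= (q0 m)%:R + \sum_(i <- s | P i) (q i m)%:R :> R) ->
  freq N p g <= freq N q0 g + \sum_(i <- s | P i) freq N (q i) g :> R.
Proof.
move=> pq; rewrite /freq -mulr_sumr -mulrDr ler_wpM2l ?invr_ge0 //.
by rewrite exchange_big -big_split /=; apply: ler_sum => i _; exact: pq.
Qed.

Lemma freq_multiple_err j d : (0 < d <= j ^ 2)%N ->
  `|freq (j ^ 12) (fun m => d %| m)%N g - (d%:R ^+ 2)^-1| <= err j :> R.
Proof.
case: d => // d /= dj; rewrite /sieve_error (bigD1 (Ordinal dj)) //= -addrA lerDl.
by rewrite addr_ge0 ?freq_ge0 // sumr_ge0.
Qed.

(** A value above [r] is above [j^2] or divisible by a number in [(r, j^2]],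
    namely itself. *)
Lemma freq_tail_le j r : (0 < r)%N ->
  freq (j ^ 12) (fun m => r < m)%N g <= r%:R^-1 + err j :> R.
Proof.
move=> r0.
apply: le_trans (_ : freq (j ^ 12) (fun m => j ^ 2 < m)%N g + \sum_(d < j ^ 2 | (r < d.+1)%N)
   freq (j ^ 12) (fun m => d.+1 %| m)%N g <= _).
  apply: freq_sum_le => m m0; case: ltnP => [rm|_]; last by rewrite addr_ge0 // sumr_ge0.
  case: ltnP => [_|mj]; first by rewrite lerDl sumr_ge0.
  have mj' : (m.-1 < j ^ 2)%N by rewrite prednK.
  rewrite add0r (bigD1 (Ordinal mj')) /= ?prednK // dvdnn lerDl.
  by rewrite sumr_ge0.
rewrite /sieve_error [leRHS]addrA [leRHS]addrC lerD2l.
apply: le_trans (_ : \sum_(d < j ^ 2 | (r < d.+1)%N)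
  (`|freq (j ^ 12) (fun m => d.+1 %| m)%N g - (d.+1%:R ^+ 2)^-1| + (d.+1%:R ^+ 2)^-1) <= _).
  by apply: ler_sum => d _; rewrite -lerBlDr ler_norm.
rewrite big_split /= addrC; apply: lerD; first exact: inv_square_tail.
rewrite [leRHS](bigID (fun d : 'I_(j ^ 2) => (r < d.+1)%N)) /= lerDl.
by rewrite sumr_ge0.
Qed.

(** A partial Euler product of [1 / zeta 2]. *)
Fixpoint rough_density r : R :=
  if r is r'.+1 then
    if prime r then rough_density r' * (1 - (r%:R ^+ 2)^-1) else rough_density r'
  else 1.

Lemma rough_density_ge0 r : 0 <= rough_density r.
Proof.
elim: r => //= r IH; case: ifP => // _; rewrite mulr_ge0 // subr_ge0 invf_le1 ?exprn_gt0 //.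
by rewrite -natrX ler1n expn_gt0.
Qed.

Lemma rough_density_le r : rough_density r.+1 <= rough_density r.
Proof.
by rewrite /=; case: ifP => // _; rewrite ler_piMr ?rough_density_ge0 // gerBl invr_ge0.
Qed.

Hypothesis err0 : (fun j => err j) @ \oo --> (0 : R).

Lemma freq_multiple_cvg d : (0 < d)%N ->
  (fun j => freq (j ^ 12) (fun m => d %| m)%N g : R) @ \oo --> ((d%:R ^+ 2)^-1 : R).
Proof.
move=> d0; apply/cvgrPdist_le => e e0.
move/cvgrPdist_le : err0 => /(_ e e0) E.
near=> j; rewrite distrC; apply: (@le_trans _ _ (err j)).
  apply: freq_multiple_err; rewrite d0 /=.
  apply: (@leq_trans j); first by near: j; exact: nbhs_infty_ge.
  by rewrite leq_pmulr //; apply: leq_trans d0 _; near: j; exact: nbhs_infty_ge.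
have : `|0 - err j| <= e by near: j.
by rewrite sub0r normrN ger0_norm ?err_ge0.
Unshelve. all: by end_near. Qed.

Lemma freq_rough_cvg r k : (0 < k)%N ->
  (fun j => freq (j ^ 12) (rough r k) g : R) @ \oo --> (rough_density r / k%:R ^+ 2 : R).
Proof.
elim: r k => [|r IH] k k0; first by rewrite mul1r; exact: freq_multiple_cvg.
have kR : k%:R != 0 :> R by rewrite pnatr_eq0 -lt0n.
have [pr|/negPf pr] := boolP (prime r.+1); last first.
  have -> : rough r.+1 k = rough r k by apply/funext => m /=; rewrite pr andbT.
  by rewrite /= pr; exact: IH.
have -> : rough_density r.+1 = rough_density r * (1 - (r.+1%:R ^+ 2)^-1) by rewrite /= pr.
have -> : (fun j => freq (j ^ 12) (rough r.+1 k) g : R) =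
   (fun j => freq (j ^ 12) (rough r k) g - freq (j ^ 12) (rough r (k * r.+1)%N) g).
  apply/funext => j; rewrite /freq -mulrBr -sumrB; congr (_ * _).
  apply: eq_bigr => i _; rewrite (rough_prime _ pr k0) /= pr /=.
  by case: rough; case: (_ %| _)%N; rewrite ?subrr ?subr0.
have -> : rough_density r * (1 - (r.+1%:R ^+ 2)^-1) / k%:R ^+ 2 =
   rough_density r / k%:R ^+ 2 - rough_density r / (k * r.+1)%:R ^+ 2.
  have pR : r.+1%:R != 0 :> R by rewrite pnatr_eq0.
  by rewrite natrM; move: (r.+1%:R) pR => p pR; field; rewrite kR pR.
by apply: cvgB; apply: IH => //; rewrite muln_gt0 k0.
Qed.

(** The sieve over-counts only values above [r], by [rough_large]. *)
Lemma freq_eq_rough j k r : (0 < k)%N -> (0 < r)%N ->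
  `|freq (j ^ 12) (pred1 k) g - freq (j ^ 12) (rough r k) g| <= r%:R^-1 + err j :> R.
Proof.
move=> k0 r0.
have h1 : freq (j ^ 12) (pred1 k) g <= freq (j ^ 12) (rough r k) g :> R.
  by apply: freq_le => m _ /eqP ->; exact: rough_self.
have h2 : freq (j ^ 12) (rough r k) g <=
    freq (j ^ 12) (pred1 k) g + freq (j ^ 12) (fun m => r < m)%N g :> R.
  have := @freq_sum_le unit [:: tt] xpredT (j ^ 12) (rough r k) (fun=> fun m => r < m)%N (pred1 k).
  rewrite big_seq1; apply=> m m0.
  rewrite big_seq1 /=; have [->|mk] := eqVneq m k.
    by rewrite -natrD ler_nat (leq_trans (leq_b1 _)).
  case: (boolP (rough r k m)) => [rk|_]; last by rewrite addr_ge0.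
  by rewrite (rough_large m0 rk mk) add0r.
have h3 := freq_tail_le j r0.
rewrite ler_norml; apply/andP; split; last first.
  have : 0 <= r%:R^-1 :> R by rewrite invr_ge0.
  have := err_ge0 j; lra.
lra.
Qed.

Definition limit_density : R := limn rough_density.

Lemma rough_density_cvg : rough_density @ \oo --> limit_density.
Proof.
apply: nonincreasing_is_cvgn.
  by apply/nonincreasing_seqP => r; exact: rough_density_le.
by exists 0 => _ [r _ <-]; exact: rough_density_ge0.
Qed.

(** The bound of [freq_eq_rough] is uniform in [j] up to the sieve error, so
    the limits in [j] and in [r] can be exchanged. *)
Lemma freq_eq_cvg k : (0 < k)%N ->
  (fun j => freq (j ^ 12) (pred1 k) g : R) @ \oo --> (limit_density / k%:R ^+ 2 : R).
Proof.
move=> k0; apply/cvgrPdist_le => e e0.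
have e4 : 0 < e / 4 by rewrite divr_gt0.
have rc : (fun r => rough_density r / k%:R ^+ 2) @ \oo --> (limit_density / k%:R ^+ 2 : R).
  by apply: cvgM; [exact: rough_density_cvg | exact: cvg_cst].
have [r [r0 r1 r2]] : exists r, [/\ (0 < r)%N, r%:R^-1 <= e / 4 &
     `|limit_density / k%:R ^+ 2 - rough_density r / k%:R ^+ 2| <= e / 4].
  move/cvgrPdist_le : rc => /(_ _ e4) E.
  have : \forall r \near \oo, [/\ (0 < r)%N, r%:R^-1 <= e / 4 &
     `|limit_density / k%:R ^+ 2 - rough_density r / k%:R ^+ 2| <= e / 4].
    near=> r; split.
    - by near: r; exact: nbhs_infty_gt.
    - rewrite -[leRHS]invrK lef_pV2 ?posrE ?invr_gt0 // ?ltr0n; last first.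
        by near: r; exact: nbhs_infty_gt.
      by near: r; exact: nbhs_infty_ger.
    - by near: r.
  by move=> [M _ h]; exists M; apply: h => /=.
move/cvgrPdist_le : (@freq_rough_cvg r k k0) => /(_ _ e4) E1.
move/cvgrPdist_le : err0 => /(_ _ e4) E2.
near=> j.
have a1 : `|rough_density r / k%:R ^+ 2 - freq (j ^ 12) (rough r k) g| <= e / 4 by near: j.
have a2 : `|0 - err j| <= e / 4 by near: j.
have a3 := freq_eq_rough j k0 r0.
have a4 : err j <= e / 4 by move: a2; rewrite sub0r normrN ger0_norm ?err_ge0.
move: r2 a1 a3; rewrite !ler_norml => /andP[? ?] /andP[? ?] /andP[? ?].
by apply/andP; split; lra.
Unshelve. all: by end_near. Qed.

(** The frequencies of all values add up to 1, and those of the values above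
    [K] contribute at most [1 / K] in the limit. *)
Lemma limit_density_mass K : (0 < K)%N ->
  `|1 - limit_density * \sum_(k < K) (k.+1%:R ^+ 2)^-1| <= K%:R^-1.
Proof.
move=> K0.
have lim : (fun j => `|1 - \sum_(k < K) freq (j ^ 12) (pred1 k.+1) g| - err j) @ \oo -->
    `|1 - limit_density * \sum_(k < K) (k.+1%:R ^+ 2)^-1| - 0.
  apply: cvgB => //; apply: cvg_norm; apply: cvgB; first exact: cvg_cst.
  rewrite mulr_sumr; apply: cvg_big => [|k _]; first exact: add_continuous.
  exact: freq_eq_cvg.
rewrite subr0 in lim.
apply: (cvgr_to_le lim); near=> j.
rewrite lerBlDr; apply: (le_trans _ (freq_tail_le j K0)).
have j0 : (0 < j ^ 12)%N by rewrite expn_gt0; apply/orP; left; near: j; exact: nbhs_infty_gt.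
suff -> : 1 - \sum_(k < K) freq (j ^ 12) (pred1 k.+1) g = freq (j ^ 12) (fun m => K < m)%N g :> R.
  by rewrite ger0_norm // freq_ge0.
apply/eqP; rewrite subr_eq; apply/eqP.
rewrite /freq -mulr_sumr -mulrDr exchange_big -big_split /=.
rewrite (eq_bigr (fun=> 1)).
  by rewrite sumr_const card_ord mulVf // pnatr_eq0 -lt0n.
move=> i _; move: (g_gt0 i.+1); case: (g i.+1) => // m _.
rewrite ltnS; case: leqP => [Km|mK].
  rewrite big1 ?addr0 // => k _; rewrite eqSS gtn_eqF // (leq_trans _ Km) //.
rewrite (bigD1 (Ordinal mK)) //= eqxx big1 ?addr0 ?add0r // => k.
by rewrite eqSS -val_eqE /= eq_sym => /negPf ->.
Unshelve. all: by end_near. Qed.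

(** Conservation of mass identifies the limit of the partial Euler products
    with the inverse of the Dirichlet series at 2, and proves the convergence
    of that series as well. *)
Lemma limit_density_zeta : limit_density = (zeta (2 : R))^-1.
Proof.
pose S K : R := \sum_(k < K) (k.+1%:R ^+ 2)^-1.
have cS : (fun K => limit_density * S K) @ \oo --> (1 : R).
  apply/cvgrPdist_le => e e0; near=> K.
  have K0 : (0 < K)%N by near: K; exact: nbhs_infty_gt.
  apply: le_trans (limit_density_mass K0) _.
  rewrite -[leRHS]invrK lef_pV2 ?posrE ?invr_gt0 // ?ltr0n //.
  by near: K; exact: nbhs_infty_ger.
have d0 : limit_density != 0.
  apply/eqP => d0; have := limit_density_mass (ltn0Sn 1).
  by rewrite d0 mul0r subr0 normr1 => ?; lra.
have cS' : S @ \oo --> limit_density^-1.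
  rewrite -[X in _ --> X]mulr1 [X in X @ _ --> _](_ : _ = fun K => limit_density^-1 * (limit_density * S K)).
    by apply: cvgM => //; exact: cvg_cst.
  by apply/funext => K; rewrite mulKf.
rewrite /zeta.
rewrite [X in limn X](_ : _ = S) ?(cvg_lim _ cS') ?invrK //.
apply/funext => N; rewrite big_add1 /= big_mkord; apply: eq_bigr => k _.
by rewrite powRN -(powR_mulrn 2).
Unshelve. all: by end_near. Qed.

End Sieve.

Section Interpolation.
Context {R : realType} (S : nat -> R) (L : R).
Hypothesis S_mono : {homo S : m n / (m <= n)%N >-> m <= n}.
Hypothesis S_ge0 : forall n, 0 <= S n.

Lemma shift_ratio_cvg a : (fun j => (j.+1%:R / j.+2%:R) ^+ a : R) @ \oo --> (1 : R).
Proof.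
have h : (fun j => 1 - (j.+2%:R)^-1 : R) @ \oo --> (1 - 0 : R).
  apply: cvgB; first exact: cvg_cst.
  have := @cvg_harmonic R; rewrite -(cvg_shiftS (harmonic : nat -> R)).
  exact.
rewrite subr0 in h.
have -> : (fun j => (j.+1%:R / j.+2%:R) ^+ a : R) = (fun j => (1 - (j.+2%:R)^-1) ^+ a).
  apply/funext => j; congr (_ ^+ _).
  have z : j.+2%:R != 0 :> R by rewrite pnatr_eq0.
  by rewrite -[j.+1%:R](addrK 1) natr1 mulrBl mulfV // mul1r.
elim: a => [|a IH]; first exact: cvg_cst.
rewrite -[X in _ --> X]mulr1; under eq_fun do rewrite exprS.
exact: cvgM.
Qed.

(** For [j^a <= N < (j + 1)^a] monotonicity puts [S N / N] between the two
    ratios that pair the numerator at one of the powers with the denominator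
    at the other, and consecutive powers have ratio tending to 1. *)
Lemma cvg_mean_of_powers a : (0 < a)%N ->
  (fun j => S (j ^ a)%N / (j ^ a)%:R) @ \oo --> L ->
  (fun N => S N / N%:R) @ \oo --> L.
Proof.
move=> a0 cS.
have L0 : 0 <= L.
  by apply: (cvgr_to_ge cS); near=> j; rewrite divr_ge0.
have cS1 : (fun j => S (j.+1 ^ a)%N / (j.+1 ^ a)%:R) @ \oo --> L.
  by rewrite (cvg_shiftS (fun j => S (j ^ a)%N / (j ^ a)%:R)).
have cS2 : (fun j => S (j.+2 ^ a)%N / (j.+2 ^ a)%:R) @ \oo --> L.
  by rewrite (cvg_shiftS (fun j => S (j.+1 ^ a)%N / (j.+1 ^ a)%:R)).
have up : (fun j => S (j.+2 ^ a)%N / (j.+1 ^ a)%:R) @ \oo --> L.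
  rewrite -[X in _ --> X]divr1.
  have -> : (fun j => S (j.+2 ^ a)%N / (j.+1 ^ a)%:R) =
    (fun j => (S (j.+2 ^ a)%N / (j.+2 ^ a)%:R) / ((j.+1%:R / j.+2%:R) ^+ a)).
    apply/funext => j; rewrite !natrX expr_div_n.
    by field; rewrite !expf_eq0 !pnatr_eq0 !andbF.
  apply: cvgM => //; apply: cvgV; first exact: oner_neq0.
  exact: shift_ratio_cvg.
have dn : (fun j => S (j.+1 ^ a)%N / (j.+2 ^ a)%:R) @ \oo --> L.
  rewrite -[X in _ --> X]mulr1.
  have -> : (fun j => S (j.+1 ^ a)%N / (j.+2 ^ a)%:R) =
    (fun j => (S (j.+1 ^ a)%N / (j.+1 ^ a)%:R) * ((j.+1%:R / j.+2%:R) ^+ a)).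
    apply/funext => j; rewrite !natrX expr_div_n.
    by field; rewrite !expf_eq0 !pnatr_eq0 !andbF.
  by apply: cvgM => //; exact: shift_ratio_cvg.
apply/cvgrPdist_le => e e0.
move/cvgrPdist_le : up => /(_ e e0) [J1 _ h1].
move/cvgrPdist_le : dn => /(_ e e0) [J2 _ h2].
pose J := maxn J1 J2.
exists (J.+1 ^ a)%N => // N /= JN.
have N0 : (0 < N)%N by apply: leq_trans JN; rewrite expn_gt0.
have [j [Jj jN Nj]] : exists j, [/\ (J <= j)%N, (j.+1 ^ a <= N)%N & (N < j.+2 ^ a)%N].
  have ex : exists i, (i.+1 ^ a <= N)%N by exists J.
  have ub i : (i.+1 ^ a <= N)%N -> (i <= N)%N.
    move=> iN; apply: leq_trans iN; apply: leq_trans (leqnSn i) _.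
    by rewrite -[X in (X <= _)%N]expn1 leq_pexp2l.
  case: (ex_maxnP ex ub) => j jN jmax; exists j; split => //; first exact: jmax.
  by rewrite ltnNge; apply/negP => /jmax; rewrite ltnn.
have k1 : `|L - S (j.+2 ^ a)%N / (j.+1 ^ a)%:R| <= e.
  by apply: h1 => /=; apply: leq_trans Jj; exact: leq_maxl.
have k2 : `|L - S (j.+1 ^ a)%N / (j.+2 ^ a)%:R| <= e.
  by apply: h2 => /=; apply: leq_trans Jj; exact: leq_maxr.
have NR : 0 < N%:R :> R by rewrite ltr0n.
have p1 : 0 < (j.+1 ^ a)%:R :> R by rewrite ltr0n expn_gt0.
have p2 : 0 < (j.+2 ^ a)%:R :> R by rewrite ltr0n expn_gt0.
have u : S N / N%:R <= S (j.+2 ^ a)%N / (j.+1 ^ a)%:R.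
  apply: ler_pM; rewrite ?invr_ge0 //.
    by apply: S_mono; exact: ltnW.
  by rewrite lef_pV2 ?posrE // ler_nat.
have l : S (j.+1 ^ a)%N / (j.+2 ^ a)%:R <= S N / N%:R.
  apply: ler_pM; rewrite ?invr_ge0 //.
    exact: S_mono.
  by rewrite lef_pV2 ?posrE // ler_nat ltnW.
move: k1 k2; rewrite !ler_norml => /andP[? ?] /andP[? ?].
by apply/andP; split; lra.
Unshelve. all: by end_near. Qed.

End Interpolation.

Lemma freq_eq_zeta {R : realType} (g : nat -> nat) k :
  (forall n, (0 < g n)%N) -> (fun j => sieve_error j g : R) @ \oo --> (0 : R) ->
  (0 < k)%N ->
  (fun N => freq N (pred1 k) g : R) @ \oo --> 1 / (k%:R ^+ 2 * zeta (2 : R)).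
Proof.
move=> g0 e0 k0.
rewrite (_ : 1 / _ = limit_density / k%:R ^+ 2); last first.
  by rewrite (limit_density_zeta g0 e0) mul1r invfM mulrC.
pose S N : R := \sum_(i < N) (pred1 k (g i.+1))%:R.
have E : (fun N => freq N (pred1 k) g : R) = (fun N => S N / N%:R).
  by apply/funext => N; rewrite /freq mulrC.
rewrite E; apply: (@cvg_mean_of_powers _ _ _ _ _ 12) => //.
- move=> m n mn; rewrite /S -(big_mkord xpredT (fun i => (pred1 k (g i.+1))%:R)).
  rewrite -[leRHS](big_mkord xpredT (fun i => (pred1 k (g i.+1))%:R)).
  by rewrite [leRHS](big_cat_nat (leq0n m) mn) /= lerDl sumr_ge0.
- by move=> n; rewrite /S sumr_ge0.
have := freq_eq_cvg g0 e0 k0.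
by under eq_fun do rewrite /freq mulrC.
Qed.

(** * The random walk *)

Lemma measurable_preimage_countType d (T : measurableType d) (U : countType) (X : T -> U) :
  (forall u, measurable (X @^-1` [set u])) -> forall B, measurable (X @^-1` B).
Proof.
move=> mX B.
have -> : X @^-1` B = \bigcup_u (if u \in B then X @^-1` [set u] else set0).
  apply/seteqP; split => w /=.
    by move=> XB; exists (X w) => //; rewrite mem_set.
  by move=> [u _]; case: ifPn => // /set_mem uB /= ->.
apply: countable_bigcupT_measurable; first exact: countableP.
by move=> u; case: ifP.
Qed.

Section NullSeries.
Context {R : realType} {d : measure_display} {T : measurableType d}.
Variable P : probability T R.

(** The sum of the series has a finite integral by monotone convergence, so it
    is finite almost everywhere and its terms tend to 0. *)
Lemma ae_cvg0_of_summable_integrals (f : nat -> T -> R) (M : R) :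
  (forall n, measurable_fun setT (f n)) ->
  (forall n w, 0 <= f n w) ->
  (forall n, (\sum_(0 <= i < n) \int[P]_w (f i w)%:E <= M%:E)%E) ->
  {ae P, forall w, (fun n => f n w) @ \oo --> (0 : R)}.
Proof.
move=> mf f0 fM.
pose F (w : T) : \bar R := (\sum_(i <oo) (f i w)%:E)%E.
have F0 n w : (0 <= (f n w)%:E)%E by rewrite lee_fin.
have mF : measurable_fun setT F by by apply: ge0_emeasurable_sum => // n _; apply/measurable_EFinP.
have FM : (\int[P]_w F w <= M%:E)%E.
  rewrite integral_nneseries //; last by move=> n; apply/measurable_EFinP.
  apply: lime_le.
    by apply: is_cvg_nneseries => n _ _; exact: integral_ge0.
  by near=> n; exact: fM.
have Fint : P.-integrable setT F.
  apply/integrableP; split => //.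
  have -> : (\int[P]_w `|F w| = \int[P]_w F w)%E.
    by apply: eq_integral => w _; rewrite gee0_abs // nneseries_ge0.
  by apply: le_lt_trans FM _; rewrite ltry.
have := integrable_ae measurableT Fint; apply: filterS => w /(_ I) Ffin.
apply: cvg_series_cvg_0; apply: nondecreasing_is_cvgn.
  by apply: nondecreasing_series => n *; exact: f0.
exists (fine (F w)) => _ [n _ <-].
rewrite -lee_fin fineK // /series /= -sumEFin.
exact: nneseries_lim_ge.
Unshelve. all: by end_near. Qed.

End NullSeries.

Section RandomWalk.
Context {R : realType} {d : measure_display} {T : measurableType d}.
Context (P : probability T R) (alpha : R) (a0 b0 : nat).
Variable Z : nat -> {RV P >-> (nat * nat)%type}.
Hypothesis walkZ : random_walk alpha a0 b0 Z.

Notation inc := (increment (fun n => Z n : T -> nat * nat)).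
Notation mean := (coin_mean alpha).

Definition right_step n (w : T) : bool := inc n w == (1, 0).
Definition flips N w : seq bool := mkseq (right_step^~ w) N.

Lemma measurable_increment n B : measurable (inc n @^-1` B).
Proof.
pose X w := (Z n w, Z n.+1 w).
pose h (p : (nat * nat) * (nat * nat)) : int * int :=
  (p.2.1%:Z - p.1.1%:Z, p.2.2%:Z - p.1.2%:Z).
rewrite (_ : inc n @^-1` B = X @^-1` (h @^-1` B)) //.
apply: measurable_preimage_countType => -[u v].
have mZ m u' : measurable (Z m @^-1` [set u']).
  rewrite -[X in measurable X]setTI; apply: (measurable_funP (Z m)) => //.
  have -> : [set u'] = [set u'.1] `*` [set u'.2].
    by case: u' => x y; apply/seteqP; split => -[? ?] /= [-> ->].
  exact: measurableX.
have -> : X @^-1` [set (u, v)] = Z n @^-1` [set u] `&` Z n.+1 @^-1` [set v].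
  by apply/seteqP; split => w /= [h1 h2]; [split|rewrite /X h1 h2].
exact: measurableI.
Qed.

(** For [false] this is the complement of a right step rather than an up step,
    so that the two events partition the space and the flips are defined
    everywhere; up steps are recovered almost surely in [ae_unit_steps]. *)
Definition step_event (b : bool) : set (int * int) :=
  if b then [set (1, 0)] else ~` [set (1, 0)].

Lemma step_eventE n b w : (inc n @^-1` step_event b) w <-> right_step n w = b.
Proof.
rewrite /right_step /step_event; case: b => /=; split.
- by move=> ->; rewrite eqxx.
- by move/eqP.
- by move=> h; apply/eqP => /h.
- by move=> /eqP.
Qed.

Definition coin_weight (b : bool) : R := if b then alpha else 1 - alpha.

Lemma step_event_prob n b : P (inc n @^-1` step_event b) = (coin_weight b)%:E.
Proof.
have right := random_walk_right walkZ n.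
case: b; first exact: right.
rewrite /step_event -preimage_setC probability_setC; last exact: measurable_increment.
by rewrite right EFinB.
Qed.

Lemma measurable_step_event b : measurable (step_event b).
Proof.
have m1 : measurable [set ((1 : int), (0 : int))].
  have -> : [set ((1 : int), (0 : int))] = [set (1 : int)] `*` [set (0 : int)].
    by apply/seteqP; split => -[? ?] /= [-> ->].
  exact: measurableX.
by case: b => //; exact: measurableC.
Qed.

(** The prescribed flips are those at the times [n, n + 1, ...], the ones
    after the first [n], because [integral_cylinder] is proved by turning the
    last flip of [flips n.+1 w] into a constraint. *)
Definition cylinder n (c : seq bool) : set T :=
  [set w | forall i, (i < size c)%N -> right_step (n + i) w = nth false c i].

Lemma cylinder_nil n : cylinder n [::] = setT.
Proof. by apply/seteqP; split. Qed.

Lemma cylinder_cons n b c :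
  cylinder n (b :: c) = inc n @^-1` step_event b `&` cylinder n.+1 c.
Proof.
apply/seteqP; split => w.
  move=> h; split; first by apply/step_eventE; have := h 0%N isT; rewrite addn0.
  by move=> i ic; rewrite addSnnS; exact: (h i.+1).
by move=> [/step_eventE h1 h2] [_|i ic]; rewrite ?addn0 //= -addSnnS; exact: h2.
Qed.

Lemma cylinder_split n c :
  cylinder n.+1 c = cylinder n (true :: c) `|` cylinder n (false :: c).
Proof.
rewrite !cylinder_cons -setIUl [X in X `&` _](_ : _ = setT) ?setTI //.
apply/seteqP; split => w // _; case E : (right_step n w); [left|right]; exact/step_eventE.
Qed.

Lemma measurable_cylinder n c : measurable (cylinder n c).
Proof.
elim: c n => [|b c IH] n; first by rewrite cylinder_nil.
by rewrite cylinder_cons; apply: measurableI => //; exact: measurable_increment.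
Qed.

Lemma cylinder_prob n c : P (cylinder n c) = (\prod_(b <- c) coin_weight b)%:E.
Proof.
pose J := [fset i | i in iota n (size c)]%fset.
pose B i := step_event (nth false c (i - n)).
have Jmem i : (i \in J) = (i \in iota n (size c)) by rewrite in_fset.
have -> : cylinder n c = \bigcap_(i in [set` J]) (inc i @^-1` B i).
  apply/seteqP; split => w.
    move=> h i /=; rewrite Jmem mem_iota => /andP[ni ic].
    by apply/step_eventE; rewrite -{1}(subnKC ni); apply: h; lia.
  move=> h i ic; have := h (n + i)%N; rewrite /= Jmem mem_iota leq_addr ltn_add2l.
  by move=> /(_ ic)/step_eventE ->; rewrite addKn.
rewrite (random_walk_indep walkZ); last by move=> i _; exact: measurable_step_event.
rewrite (perm_big (iota n (size c))) /=; last first.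
  by apply: uniq_perm; rewrite ?fset_uniq ?iota_uniq // => i; exact: Jmem.
rewrite (eq_bigr (fun i => (coin_weight (nth false c (i - n)))%:E)); last first.
  by move=> i _; exact: step_event_prob.
rewrite prodEFin; congr EFin.
rewrite -[n in iota n]addn0 iotaDl big_map (big_nth false) /index_iota subn0.
by apply: eq_bigr => i _; rewrite addKn.
Qed.

Lemma measurable_flips N (S : set (seq bool)) : measurable (flips N @^-1` S).
Proof.
apply: measurable_preimage_countType => s.
have [sN|sN] := eqVneq (size s) N; last first.
  rewrite (_ : _ @^-1` _ = set0) //; apply/seteqP; split => w //= sE.
  by move: sN; rewrite -sE size_mkseq eqxx.
rewrite (_ : _ @^-1` _ = cylinder 0 s); first exact: measurable_cylinder.
apply/seteqP; split => w /=.
  by move=> <- i; rewrite size_mkseq => iN; rewrite nth_mkseq.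
move=> h; apply: (@eq_from_nth _ false); rewrite size_mkseq // => i iN.
by rewrite nth_mkseq // -h ?sN.
Qed.

Lemma measurable_fun_flips N (D : set T) (g : seq bool -> R) :
  measurable D -> measurable_fun D (fun w => g (flips N w)).
Proof.
move=> mD _ B mB; apply: measurableI => //.
exact: (measurable_flips N (g @^-1` B)).
Qed.

(** Transfer from the probability space to [coin_mean]. The induction on [N]
    splits the cylinder according to the flip at time [N], which moves one
    flip from the integrand to the constraints. *)
Lemma integral_cylinder N (g : seq bool -> R) c : (forall s, 0 <= g s) ->
  (\int[P]_(w in cylinder N c) (g (flips N w))%:E =
   (mean N g * \prod_(b <- c) coin_weight b)%:E)%E.
Proof.
elim: N g c => [|N IH] g c g0.
  apply: (etrans (integral_cst P (measurable_cylinder 0 c) (g [::])%:E)).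
  by rewrite EFinM; congr (_ * _)%E; exact: cylinder_prob.
rewrite cylinder_split ge0_integral_setU; first last.
- rewrite disj_set2E; apply/eqP/seteqP; split => w //.
  by rewrite !cylinder_cons => -[[/step_eventE h1 _] [/step_eventE h2 _]]; rewrite h1 in h2.
- by move=> w _; rewrite lee_fin.
- by apply/measurable_EFinP; apply: measurable_fun_flips; apply: measurableU; exact: measurable_cylinder.
- exact: measurable_cylinder.
- exact: measurable_cylinder.
have restrict b : (\int[P]_(w in cylinder N (b :: c)) (g (flips N.+1 w))%:E =
    \int[P]_(w in cylinder N (b :: c)) (g (rcons (flips N w) b))%:E)%E.
  apply: eq_integral => w /set_mem; rewrite cylinder_cons => -[/step_eventE h _].
  by rewrite /flips mkseqS h.
rewrite !restrict (IH (fun s => g (rcons s true))) // (IH (fun s => g (rcons s false))) //.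
rewrite -EFinD !big_cons /= coin_meanD !coin_meanZ; congr EFin.
rewrite /coin_weight; ring.
Qed.

Lemma integral_flips N (g : seq bool -> R) : (forall s, 0 <= g s) ->
  (\int[P]_w (g (flips N w))%:E = (mean N g)%:E)%E.
Proof.
by move=> g0; rewrite -(cylinder_nil N) integral_cylinder // big_nil mulr1.
Qed.

Lemma ae_unit_steps : {ae P, forall w, forall n, inc n w = (1, 0) \/ inc n w = (0, 1)}.
Proof.
apply: ae_foralln => n.
pose E := inc n @^-1` [set (1, 0)] `|` inc n @^-1` [set (0, 1)].
have mE : measurable E by apply: measurableU; exact: measurable_increment.
have PE : P E = 1%E.
  apply: etrans (measureU P _ _ _) _; try exact: measurable_increment.
    by apply/seteqP; split => w //= [->].
  apply: etrans (congr2 adde (random_walk_right walkZ n) (random_walk_up walkZ n)) _.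
  by apply: (congr1 EFin); rewrite addrC subrK.
exists (~` E); split; first exact: measurableC.
  by apply: (etrans (probability_setC P mE)); rewrite PE subee.
by move=> w /= h Ew; apply: h; case: Ew; [left|right].
Qed.

Lemma position w : (forall n, inc n w = (1, 0) \/ inc n w = (0, 1)) ->
  forall n, (Z n w).1 = (a0 + count id (flips n w))%N /\
            ((Z n w).1 + (Z n w).2 = a0 + b0 + n)%N.
Proof.
move=> unit; elim=> [|n [IH1 IH2]].
  by rewrite (random_walk_start walkZ) /= !addn0.
rewrite /flips mkseqS -cats1 count_cat /= -/(flips n w) /right_step.
case: (unit n) => h; rewrite h /=; move: h => [];
  by move: IH1 IH2; case: (Z n w) (Z n.+1 w) => x y [x' y'] /=; lia.
Qed.

Lemma gcd_position w : (forall n, inc n w = (1, 0) \/ inc n w = (0, 1)) ->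
  forall N n, (n <= N)%N ->
  walk_gcd a0 (a0 + b0) (flips N w) n = gcdn (Z n w).1 (Z n w).2.
Proof.
move=> unit N n nN; have [h1 h2] := position unit n.
rewrite /walk_gcd -h2 /heads {1}/flips /mkseq -map_take take_iota (minn_idPl nN).
rewrite -/(mkseq _ n) -/(flips n w) -h1.
by rewrite gcdnDl.
Qed.

Lemma ae_sieve_error_cvg0 : 0 < alpha < 1 ->
  {ae P, forall w, (fun j => sieve_error j (fun n => gcdn (Z n w).1 (Z n w).2)) @ \oo --> (0 : R)}.
Proof.
move=> alpha01; have [C boundC] := mean_sieve_error alpha01 a0 (a0 + b0).
pose G j s : R := sieve_error j (walk_gcd a0 (a0 + b0) s).
have G0 j s : 0 <= G j s by exact: err_ge0.
have C0 : 0 <= C.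
  have := boundC 1%N isT; rewrite expr1n divr1; apply: le_trans.
  rewrite -[leLHS](coin_mean_cst alpha (1 ^ 12)); apply: coin_mean_le => // s _.
  exact: G0.
have ae0 : {ae P, forall w, (fun j => G j.+1 (flips (j.+1 ^ 12) w)) @ \oo --> (0 : R)}.
  apply: (@ae_cvg0_of_summable_integrals _ _ _ P _ (C * 2)) => [n|n w|n].
  - exact: measurable_fun_flips.
  - exact: G0.
  rewrite (eq_bigr (fun j => (mean (j.+1 ^ 12) (G j.+1))%:E)); last first.
    by move=> j _; exact: integral_flips.
  rewrite sumEFin lee_fin.
  apply: (@le_trans _ _ (\sum_(0 <= j < n) C * (j.+1%:R ^+ 2)^-1)).
    by apply: ler_sum => j _; exact: boundC.
  rewrite -mulr_sumr ler_wpM2l // big_mkord.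
  case: n => [|n]; first by rewrite big_ord0.
  have := @inv_square_tail R 1 n.+1 isT.
  by rewrite big_mkcond !big_ord_recl /= invr1 add0r expr1n invr1; lra.
apply: filterS2 ae0 ae_unit_steps => w cvgG unit.
rewrite -cvg_shiftS /=.
rewrite [X in X @ _ --> _](_ : _ = fun j => G j.+1 (flips (j.+1 ^ 12) w)) //.
apply/funext => j; rewrite /G /sieve_error /freq; apply/esym.
have E N (p : pred nat) : \sum_(i < N) (p (walk_gcd a0 (a0 + b0) (flips N w) i.+1))%:R =
   \sum_(i < N) (p (gcdn (Z i.+1 w).1 (Z i.+1 w).2))%:R :> R.
  by apply: eq_bigr => i _; rewrite (gcd_position unit (ltn_ord i)).
rewrite (E _ (fun m => j.+1 ^ 2 < m)%N); congr (_ + _).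
by apply: eq_bigr => e _; rewrite (E _ (fun m => e.+1 %| m)%N).
Qed.

End RandomWalk.

Theorem theorem4p4 (R : realType) (d : measure_display) (T : measurableType d)
    (P : probability T R) (alpha : R) (a0 b0 : nat)
    (Z : nat -> {RV P >-> (nat * nat)%type}) :
  0 < alpha < 1 -> (0 < a0)%N -> (0 < b0)%N ->
  random_walk alpha a0 b0 Z ->
  {ae P, forall w, forall k : nat, (0 < k)%N ->
    (fun N : nat =>
       N%:R^-1 * \sum_(1 <= n < N.+1) gcd_indicator R k (Z n w)) @ \oo -->
    1 / (k%:R ^+ 2 * zeta (2 : R))}.
Proof.
move=> alpha01 a_gt0 b_gt0 walkZ.
apply: filterS2 (ae_sieve_error_cvg0 walkZ alpha01) (ae_unit_steps walkZ).
move=> w err0 unit k k0.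
pose g n := gcdn (Z n w).1 (Z n w).2.
have g_gt0 n : (0 < g n)%N.
  by rewrite gcdn_gt0; have [-> _] := position walkZ unit n; rewrite addn_gt0 a_gt0.
rewrite [X in X @ _ --> _](_ : _ = fun N => freq N (pred1 k) g).
  exact: freq_eq_zeta.
by apply/funext => N; rewrite /freq big_add1 /= big_mkord.
Qed.
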